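(* Let $\mathbf{L}=(l_1,\dots,l_n)$, $l_j:\mathbb{B}^n\to\mathbb{R}_+$, be such that $\mathbf{L}(Re^{i\Theta})$ is a positive continuously differentiable function in each variable $r_k$, $k\in\{1,\dots,n\}$, for $R\in\mathbb{R}^n_+$, $|R|<1$, $\Theta\in[0,2\pi]^n$. Suppose $\mathbf{L}$ satisfies $l_j(z)>\beta/(1-|z|)$ for all $z\in\mathbb{B}^n$ and all $j$, and an analytic function $F:\mathbb{B}^n\to\mathbb{C}$ has bounded $\mathbf{L}$-index $N=N(F,\mathbf{L},\mathbb{B}^n)$ in joint variables. Then: (i) For every $\Theta\in[0,2\pi]^n$ and every $R\in\mathbb{R}^n_+\setminus\{\mathbf{0}\}$ with $|R|<1$, $$\ln\max\left\{\frac{|F^{(S)}(Re^{i\Theta})|}{S!\mathbf{L}^S(Re^{i\Theta})}:\|S\|\le N\right\}\le\ln\max\left\{\frac{|F^{(S)}(\mathbf{0})|}{S!\mathbf{L}^S(\mathbf{0})}:\|S\|\le N\right\}$$ $$+\int_0^{r^*}\left(\max_{\|S\|\le N}\left\{\sum_{j=1}^n\frac{r_j}{r^*}(s_j+1)\,l_j\left(\frac{\tau}{r^*}Re^{i\Theta}\right)\right\}+\max_{\|S\|\le N}\left\{\sum_{j=1}^n\frac{s_j(-u_j'(\tau))^+}{l_j\left(\frac{\tau}{r^*}Re^{i\Theta}\right)}\right\}\right)d\tau .$$ (ii) If, in addition, there exists $C>0$ such that $$\sup_{|R|<1}\ \max_{t\in[0,r^*]}\ \max_{\Theta\in[0,2\pi]^n}\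 \max_{1\le j\le n}\frac{(-(u_j(t,R,\Theta))'_t)^+}{\frac{r_j}{r^*}\,l_j^2\left(\frac{t}{r^*}Re^{i\Theta}\right)}\le C,$$ then $$\limsup_{|R|\to1-0}\frac{\ln\max\{|F(z)|:z\in\mathbb{T}^n(\mathbf{0},R)\}}{\max\limits_{\Theta\in[0,2\pi]^n}\int_0^{r^*}\sum_{j=1}^n\frac{r_j}{r^*}l_j\left(\frac{\tau}{r^*}Re^{i\Theta}\right)d\tau}\le(C+1)N+1.$$ (iii) If $\dfrac{r^*(-(u_j(t,R,\Theta))'_t)^+}{r_j\,l_j^2\left(\frac{t}{r^*}Re^{i\Theta}\right)}\to0$ as $|R|\to1-0$, uniformly for all $\Theta\in[0,2\pi]^n$, $j\in\{1,\dots,n\}$, $t\in[0,r^*]$, then $$\limsup_{|R|\to1-0}\frac{\ln\max\{|F(z)|:z\in\mathbb{T}^n(\mathbf{0},R)\}}{\max\limits_{\Theta\in[0,2\pi]^n}\int_0^{r^*}\sum_{j=1}^n\frac{r_j}{r^*}l_j\left(\frac{\tau}{r^*}Re^{i\Theta}\right)d\tau}\le N+1.$$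
   Context: $\mathbb{R}_+=[0,\infty)$, $\mathbb{Z}_+=\{0,1,2,\dots\}$. $|\cdot|$ is the Euclidean norm on $\mathbb{C}^n$ (and on $\mathbb{R}^n$); $\mathbb{B}^n=\{z\in\mathbb{C}^n:|z|<1\}$; $\beta>\sqrt n$ is a fixed constant. For $S=(s_1,\dots,s_n)\in\mathbb{Z}^n_+$: $\|S\|=s_1+\dots+s_n$, $S!=s_1!\cdots s_n!$, $A^S=a_1^{s_1}\cdots a_n^{s_n}$, $F^{(S)}=\partial^{\|S\|}F/\partial z_1^{s_1}\cdots\partial z_n^{s_n}$. For $R=(r_1,\dots,r_n)\in\mathbb{R}^n_+$, $\Theta\in[0,2\pi]^n$: $Re^{i\Theta}=(r_1e^{i\theta_1},\dots,r_ne^{i\theta_n})$, $\mathbb{T}^n(\mathbf{0},R)=\{z:|z_j|=r_j\ \forall j\}$, $r^*=\max_{1\le j\le n}r_j\ne0$. $a^+=\max\{a,0\}$. $u_j(t)=u_j(t,R,\Theta)=l_j\left(\frac{tR}{r^*}e^{i\Theta}\right)$ for $t\ge0$ with $\frac{t}{r^*}|R|<1$; $u_j'$ and $(u_j)'_t$ denote the derivative in $t$. The quotients with $r_j$ in the denominator in (ii), (iii) are considered for $R$ with all $r_j>0$. $\ln0=-\infty$. An analytic $F:\mathbb{B}^n\to\mathbb{C}$ is of bounded $\mathbf{L}$-index in joint variables if there is $m\in\mathbb{Z}_+$ such that for all $z\in\mathbb{B}^n$ and $J\in\mathbb{Z}^n_+$: $\frac{|F^{(J)}(z)|}{J!\mathbf{L}^J(z)}\le\max\{\frac{|F^{(K)}(z)|}{K!\mathbf{L}^K(z)}:K\in\mathbb{Z}^n_+,\|K\|\le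 m\}$; the least such $m$ is $N(F,\mathbf{L},\mathbb{B}^n)$. *)

(* Defs.v *)
(* Over an arbitrary R : realType, points of C^n are row vectors 'rV[R[i]]_n. *)
From HB Require Import structures.
From mathcomp Require Import all_boot all_order all_algebra.
From mathcomp Require Import complex.
From mathcomp Require Import all_classical all_reals all_analysis.

Set Implicit Arguments.
Unset Strict Implicit.
Unset Printing Implicit Defensive.

Import Order.TTheory GRing.Theory Num.Theory.
Import numFieldNormedType.Exports.

Local Open Scope classical_set_scope.
Local Open Scope ring_scope.

(* The usual topology and norm on R[i], so that convergence and (complex)
   derivatives 'D_v make sense for functions into R[i]. *)
#[warnings="-redundant-canonical-projection"]
HB.instance Definition _ (R : realType) := NormedModule.copy R[i] R[i]^o.

(* `|z| on R[i] is R[i]-valued; normc is the R-valued modulus. *)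
Notation normc := Normc.normc.

Section MultiIndex.
Context {n : nat}.

Definition mindex := {ffun 'I_n -> nat}.

Definition mnorm (S : mindex) : nat := (\sum_(i < n) S i)%N.

Definition mfact (S : mindex) : nat := (\prod_(i < n) (S i)`!)%N.

Definition mpow {K : nzRingType} (A : 'I_n -> K) (S : mindex) : K :=
  \prod_(i < n) A i ^+ S i.

(* Multi-indices with ||S|| <= m have entries <= m, so they are enumerated by
   the finite type {ffun 'I_n -> 'I_m.+1}. *)
Definition mindex_of {m : nat} (S : {ffun 'I_n -> 'I_m.+1}) : mindex :=
  [ffun i => nat_of_ord (S i)].

(* max of f S over ||S|| <= m, for nonnegative f. *)
Definition mmax {R : realType} (m : nat) (f : mindex -> R) : R :=
  \big[Num.max/0]_(S : {ffun 'I_n -> 'I_m.+1} | (mnorm (mindex_of S) <= m)%N)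
    f (mindex_of S).

Definition msum {K : nzRingType} (m : nat) (f : mindex -> K) : K :=
  \sum_(S : {ffun 'I_n -> 'I_m.+1} | (mnorm (mindex_of S) <= m)%N)
    f (mindex_of S).

End MultiIndex.
Arguments mindex : clear implicits.

Section Ball.
Context {R : realType} {n : nat}.

Definition enorm (r : 'rV[R]_n) : R := Num.sqrt (\sum_(j < n) r 0 j ^+ 2).

Definition cnorm (z : 'rV[R[i]]_n) : R :=
  Num.sqrt (\sum_(j < n) normc (z 0 j) ^+ 2).

Definition cball : set 'rV[R[i]]_n := [set z | cnorm z < 1].

(* F is, near each point of the ball, the sum of an absolutely convergent
   multiple power series. *)
Definition analytic_on_ball (F : 'rV[R[i]]_n -> R[i]) : Prop :=
  forall a, cball a ->
  exists (c : mindex n -> R[i]) (rho : R), 0 < rho /\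
    forall z : 'rV[R[i]]_n, (forall j, normc (z 0 j - a 0 j) < rho) ->
      (\esum_(S in [set: mindex n])
         (normc (c S) * mpow (fun j => normc (z 0 j - a 0 j)) S)%:E < +oo)%E /\
      (fun m : nat => msum m (fun S => c S * mpow (fun j => z 0 j - a 0 j) S))
        @ \oo --> F z.

Definition mderiv (S : mindex n) (F : 'rV[R[i]]_n -> R[i]) :
    'rV[R[i]]_n -> R[i] :=
  foldr (fun (k : 'I_n) G => iter (S k) (fun H => 'D_(delta_mx 0 k) H) G)
    F (enum 'I_n).

Implicit Types (F : 'rV[R[i]]_n -> R[i]) (L : 'I_n -> 'rV[R[i]]_n -> R).

Definition Lcoef F L (S : mindex n) (z : 'rV[R[i]]_n) : R :=
  normc (mderiv S F z) / ((mfact S)%:R * mpow (L ^~ z) S).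

Definition Lindex_bound F L (m : nat) : Prop :=
  forall z, cball z -> forall J : mindex n,
    Lcoef F L J z <= mmax m (fun K => Lcoef F L K z).

(* F has bounded L-index in joint variables and N is its value. *)
Definition has_Lindex F L (N : nat) : Prop :=
  Lindex_bound F L N /\ forall m, Lindex_bound F L m -> (N <= m)%N.

(* The difference quotients of f at x in direction v, over those increments
   h != 0 that stay in D; one-sided when x is on the boundary of D. *)
Definition dquot_within {V : normedModType R} (D : set V) (f : V -> R)
    (x v : V) : set_system R :=
  (fun h : R => h^-1 * (f (x + h *: v) - f x))
    @ within [set h : R | D (x + h *: v)] (0 : R)^'.

Definition derive_within {V : normedModType R} (D : set V) (f : V -> R)
    (x v : V) : R :=
  lim (dquot_within D f x v).

Definition radii : set 'rV[R]_n :=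
  [set r : 'rV[R]_n | (forall j, 0 <= r 0 j) /\ enorm r < 1].

Definition angles : set 'rV[R]_n :=
  [set th : 'rV[R]_n | forall j, 0 <= th 0 j <= 2 * pi].

(* R e^(i Theta) *)
Definition polar (r th : 'rV[R]_n) : 'rV[R[i]]_n :=
  \row_(j < n) ((r 0 j * cos (th 0 j)) +i* (r 0 j * sin (th 0 j)))%C.

Definition torus (r : 'rV[R]_n) : set 'rV[R[i]]_n :=
  [set z | forall j, normc (z 0 j) = r 0 j].

(* For each Theta, R |-> f (R e^(i Theta)) has partial derivatives with
   respect to each r_k (one-sided where r_k = 0), continuous on radii. *)
Definition radially_C1 (f : 'rV[R[i]]_n -> R) : Prop :=
  forall th, angles th -> forall k : 'I_n,
  exists g : 'rV[R]_n -> R,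
    {within radii, continuous g} /\
    forall r, radii r ->
      dquot_within radii (fun q => f (polar q th)) r (delta_mx 0 k) --> g r.

Definition rstar (r : 'rV[R]_n) : R := \big[Num.max/0]_(j < n) r 0 j.

(* u_j(t, R, Theta) = l_j ((t / r^* ) R e^(i Theta)) *)
Definition ufun L (j : 'I_n) (r th : 'rV[R]_n) (t : R) : R :=
  L j (polar ((t / rstar r) *: r) th).

(* (u_j)'_t, relative to the t >= 0 for which (t / r^* )|R| < 1. *)
Definition dufun L (j : 'I_n) (r th : 'rV[R]_n) (t : R) : R :=
  derive_within [set t : R | 0 <= t /\ t / rstar r * enorm r < 1]
    (ufun L j r th) t 1.

Definition pospart (a : R) : R := Num.max a 0.

(* |R| -> 1-0, for R with nonnegative coordinates. *)
Definition to_sphere : set_system 'rV[R]_n :=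
  filter_from [set d : R | 0 < d]
    (fun d => [set r : 'rV[R]_n | (forall j, 0 <= r 0 j) /\ 1 - d < enorm r < 1]).

(* Suprema in \bar R stand for the maxima over the torus and over Theta;
   lne 0 = -oo. *)
Definition growth_ratio F L (r : 'rV[R]_n) : \bar R :=
  (lne (ereal_sup [set (normc (F z))%:E | z in torus r]) /
   ereal_sup [set \int[lebesgue_measure]_(tau in `[0%R, rstar r])
                    (\sum_(j < n) r 0 j / rstar r * ufun L j r th tau)%:E
             | th in angles])%E.

End Ball.
Arguments to_sphere : clear implicits.

(* Main.v *)
Require Import Defs.
From mathcomp Require Import all_boot all_order all_algebra.
From mathcomp Require Import complex.
From mathcomp Require Import all_classical all_reals all_analysis.
From mathcomp Require Import ring lra.
Import Order.TTheory GRing.Theory Num.Theory.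
Import numFieldNormedType.Exports.
Local Open Scope classical_set_scope.
Local Open Scope ring_scope.

(** Follow the ray z(t) = (t / rstar) R e^(i Theta) from the origin, and let g(t)
    be the maximum of |F^(S)(z(t))| / (S! L^S(z(t))) over ||S|| <= N.  The
    t-derivative of F^(S)(z(t)) is a combination of the F^(S + e_k)(z(t)) with
    coefficients of modulus r_k / rstar.  As N bounds the L-index,
    |F^(S + e_k)| <= (S + e_k)! L^(S + e_k) g holds even for ||S|| = N, so the
    numerators raise g at a rate of at most
    g max_S sum_j (r_j / rstar) (s_j + 1) l_j, and the denominators at a rate of
    at most g max_S sum_j s_j (- u_j')^+ / u_j.  Thus g' <= phi g, with phi the
    integrand of (i), and (i) is the Gronwall inequality for g
    ([ray_index_growth]).  A maximum of moduli need not be differentiable, so the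
    inequality is used for upper right Dini derivatives, and for ln (g + eta)
    with eta tending to 0, because g may vanish.

    Three ingredients carry this argument.
    - The local power series of F can be differentiated term by term on the whole
      polydisc.  Hence partial derivatives commute ([derive_mderiv]) and every
      F^(S) is complex differentiable ([mderiv_differentiable]).
    - The functions l_j only have continuous partial derivatives in the r_k,
      one-sided where r_k = 0.  Changing one coordinate at a time gives the chain
      rule along rays ([ray_derivative]).
    - A function whose upper right Dini derivative is at most phi grows by at most
      the integral of phi ([dini_le_integral]).

    For (ii) and (iii), a bound (- u_j')^+ <= c (r_j / rstar) u_j^2 makes phi at
    most (c + 1) N + 1 times sum_j (r_j / rstar) l_j, so on the torus ln |F| is at
    most a constant plus (c + 1) N + 1 times the denominator of the growth ratio
    ([torus_growth]).  The denominator tends to infinity at the sphere because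
    l_j > beta / (1 - |z|) ([ray_integral_ge]), which removes the constant in the
    limit.  The bound on u_j' is assumed for R with positive coordinates only,
    while the upper limit runs over nonnegative ones; it extends by continuity
    ([slope_bound_closure]). *)

(** * Multi-indices and finite sums over them *)

(* the sum over multi-indices, not the sum of two measures *)
Local Notation msum := Defs.msum.

Section MultiIndices.
Context {n : nat}.
Implicit Types (S T : mindex n) (k : 'I_n).

(** A list rather than a finite type, so that ranges for different m live in one
    type and sums over them are compared by permutation. *)
Definition mindices (m : nat) : seq (mindex n) :=
  [seq mindex_of U | U <- enum {: {ffun 'I_n -> 'I_m.+1}} & (mnorm (mindex_of U) <= m)%N].

(** The multi-index S + e_k. *)
Definition mincr k S : mindex n := [ffun j => (S j + (j == k))%N].

Lemma mindex_of_inj m : injective (@mindex_of n m).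
Proof.
by move=> S T /ffunP eqST; apply/ffunP => j; apply/val_inj; have := eqST j; rewrite !ffunE.
Qed.

Lemma uniq_mindices m : uniq (mindices m).
Proof. by rewrite map_inj_uniq; [exact/filter_uniq/enum_uniq | exact: mindex_of_inj]. Qed.

Lemma mem_mindices m S : (S \in mindices m) = (mnorm S <= m)%N.
Proof.
apply/idP/idP => [/mapP[T]|mS]; first by rewrite mem_filter => /andP[mT _] ->.
have Slt j : (S j < m.+1)%N.
  by rewrite ltnS (leq_trans _ mS)// /mnorm (bigD1 j)//= leq_addr.
have eS : S = mindex_of [ffun j => Ordinal (Slt j)].
  by apply/ffunP => j; rewrite !ffunE.
by rewrite eS map_f// mem_filter -eS mS mem_enum.
Qed.

Lemma msumE {K : nzRingType} m (f : mindex n -> K) :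
  msum m f = \sum_(S <- mindices m) f S.
Proof. by rewrite big_map big_filter big_enum_cond/=. Qed.

Lemma mmaxE {R : realType} m (f : mindex n -> R) :
  mmax m f = \big[Num.max/0]_(S <- mindices m) f S.
Proof. by rewrite big_map big_filter big_enum_cond/=. Qed.

Lemma mnorm_incr k S : mnorm (mincr k S) = (mnorm S).+1.
Proof.
rewrite /mnorm (eq_bigr (fun j => (S j + (j == k))%N)); last by move=> j _; rewrite ffunE.
rewrite big_split/= -addn1; congr addn.
by rewrite (bigD1 k)//= eqxx big1 ?addn0// => j /negbTE ->.
Qed.

Lemma mincr_inj k : injective (mincr k).
Proof.
by move=> S T /ffunP eqST; apply/ffunP => j; have := eqST j; rewrite !ffunE => /addIn.
Qed.

Lemma mincr_pred k S : (0 < S k)%N -> S = mincr k [ffun j => (S j - (j == k))%N].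
Proof.
move=> Sk; apply/ffunP => j; rewrite !ffunE subnK//.
by case: eqP => // ->.
Qed.

(** Adding e_k is a bijection onto the multi-indices with positive k-th entry and
    raises the order by one.  This turns the termwise k-th derivative of a partial
    sum of order m + 1 into a partial sum of order m. *)
Lemma msum_incr {K : nzRingType} m k (f : mindex n -> K) :
  (forall S, S k = 0%N -> f S = 0) ->
  msum m (fun T => f (mincr k T)) = msum m.+1 f.
Proof.
move=> f0; rewrite !msumE [RHS](bigID (fun S => 0 < S k)%N)/= [RHS]addrC.
rewrite [X in _ = X + _]big1 ?add0r; last first.
  by move=> S; rewrite -eqn0Ngt => /eqP /f0.
rewrite -[RHS]big_filter -(big_map (mincr k) predT f); apply: perm_big.
apply: uniq_perm.
- by rewrite (map_inj_uniq (mincr_inj k)) uniq_mindices.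
- by rewrite filter_uniq ?uniq_mindices.
move=> S; rewrite mem_filter mem_mindices; apply/mapP/andP => [[T]|[Sk Sm]].
  by rewrite mem_mindices => Tm ->; rewrite mnorm_incr ltnS ffunE eqxx addn1.
rewrite {1}(mincr_pred _ _ Sk); eexists; last by [].
by rewrite mem_mindices -ltnS -(mnorm_incr k) -mincr_pred.
Qed.

End MultiIndices.

Section FiniteMultiSums.
Context {R : realType} {n : nat}.
Implicit Types (f g : mindex n -> R) (m : nat).

Lemma msum_homo f : (forall S, 0 <= f S) ->
  {homo (fun m => msum m f) : m p / (m <= p)%N >-> m <= p}.
Proof.
move=> f0 m p mp; rewrite !msumE.
rewrite [leRHS](bigID (fun S => mnorm S <= m)%N)/= -[leLHS]addr0 lerD ?sumr_ge0//.
rewrite -[leRHS]big_filter le_eqVlt; apply/orP; left; apply/eqP.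
apply: perm_big; apply: uniq_perm; rewrite ?filter_uniq ?uniq_mindices//.
move=> S; rewrite mem_filter !mem_mindices.
by case: (leqP (mnorm S) m) => //= /leq_trans ->.
Qed.

Lemma esum_msum_bounded f : (forall S, 0 <= f S) ->
  (\esum_(S in [set: mindex n]) (f S)%:E < +oo)%E ->
  exists M, forall m, msum m f <= M.
Proof.
move=> f0 foo.
have E0 : (0 <= \esum_(S in [set: mindex n]) (f S)%:E)%E.
  by apply: esum_ge0 => S _; rewrite lee_fin.
exists (fine (\esum_(S in [set: mindex n]) (f S)%:E)) => m.
rewrite -lee_fin fineK ?ge0_fin_numE// msumE.
apply: esum_ge; exists [set` mindices m].
  by split => //; exact: finite_seq.
by rewrite -sumEFin fsbig_seq ?uniq_mindices.
Qed.

Lemma mmax_ge m f S : (mnorm S <= m)%N -> f S <= mmax m f.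
Proof. by move=> Sm; rewrite mmaxE; apply: le_bigmax_seq; rewrite ?mem_mindices. Qed.

Lemma mmax_le m f x : 0 <= x -> (forall S, (mnorm S <= m)%N -> f S <= x) ->
  mmax m f <= x.
Proof.
move=> x0 fx; rewrite mmaxE big_seq_cond; apply: bigmax_le => // S.
by rewrite mem_mindices andbT => /fx.
Qed.

Lemma mmax_ge0 m f : 0 <= mmax m f.
Proof. by rewrite /mmax; exact: bigmax_ge_id. Qed.

End FiniteMultiSums.

(** * Moduli and limits of complex numbers *)

Local Notation "x %:C" := (real_complex _ x) (format "x %:C") : ring_scope.
Section ComplexNorm.
Context {R : realType}.
Implicit Types (x y z : R[i]) (e : R).

Lemma normrC x : `|x| = (normc x)%:C.
Proof. by case: x => a b; rewrite normc_def. Qed.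

Lemma normc_ge0 x : 0 <= normc x.
Proof. by rewrite -lecR -normrC normr_ge0. Qed.

Lemma normcX x k : normc (x ^+ k) = normc x ^+ k.
Proof.
elim: k => [|k IH]; first exact: Normc.normc1.
by rewrite !exprS Normc.normcM IH.
Qed.

Lemma normc_real (a : R) : normc a%:C = `|a|.
Proof. by rewrite /= expr0n/= addr0 sqrtr_sqr. Qed.

Lemma normc_leD x y : normc (x + y) <= normc x + normc y.
Proof. exact: le_normcD. Qed.

Lemma normc_opp x : normc (- x) = normc x.
Proof. exact: normcN. Qed.

Lemma normc_sum (I : Type) (s : seq I) (P : pred I) (F : I -> R[i]) :
  normc (\sum_(i <- s | P i) F i) <= \sum_(i <- s | P i) normc (F i).
Proof.
elim/big_rec2: _ => [|i a b _ H]; first by rewrite Normc.normc0.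
by rewrite (le_trans (normc_leD _ _))// lerD2l.
Qed.

Lemma normc_prod (I : Type) (s : seq I) (P : pred I) (F : I -> R[i]) :
  normc (\prod_(i <- s | P i) F i) = \prod_(i <- s | P i) normc (F i).
Proof.
elim/big_rec2: _ => [|i a b _ H]; first exact: Normc.normc1.
by rewrite Normc.normcM H.
Qed.

(** The norm on R[i] is R[i]-valued; estimates below are carried out with the real
    modulus. *)
Lemma cvgcP {T : Type} {G : set_system T} {FG : Filter G} (f : T -> R[i]) l :
  f @ G --> l <-> forall e, 0 < e -> \forall t \near G, normc (l - f t) < e.
Proof.
split=> [/cvgrPdist_lt H e e0|H].
  have /H : 0 < e%:C by rewrite ltcR.
  by apply: filterS => t; rewrite normrC ltcR.
apply/cvgrPdist_lt => -[a b]; rewrite ltcE/= => /andP[/eqP b0 a0].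
by have := H a a0; apply: filterS => t; rewrite normrC b0 ltcR.
Qed.

Lemma cvgc_le_norm {T : Type} {G : set_system T} {FG : ProperFilter G}
    (f : T -> R[i]) l M :
  f @ G --> l -> (\forall t \near G, normc (f t) <= M) -> normc l <= M.
Proof.
move=> /cvgcP fl fM; apply/ler_addgt0Pr => e e0.
have [t [flt fMt]] := filter_ex (filterI (fl e e0) fM).
by rewrite -(subrK (f t) l) (le_trans (normc_leD _ _))// addrC lerD// ltW.
Qed.

Lemma cvgc_re_im {T : Type} {G : set_system T} {FG : Filter G} (f : T -> R[i])
    (a b : R) :
  (fun t => complex.Re (f t)) @ G --> a -> (fun t => complex.Im (f t)) @ G --> b ->
  f @ G --> (a +i* b)%C.
Proof.
move=> /cvgrPdist_lt fa /cvgrPdist_lt fb; apply/cvgcP => e e0.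
have e20 : 0 < e / 2 by rewrite divr_gt0.
apply: filterS (filterI (fa _ e20) (fb _ e20)) => t [].
case: (f t) => x y xa yb.
have -> : (a +i* b - x +i* y = (a - x)%:C + 'i * (b - y)%:C)%C.
  by apply/eqP; rewrite eq_complex/=; apply/andP; split; apply/eqP; ring.
rewrite (le_lt_trans (normc_leD _ _))// Normc.normcM !normc_real.
have -> : normc ('i : R[i])%C = 1 by rewrite /= expr0n expr1n add0r sqrtr1.
by rewrite mul1r [e]splitr ltrD.
Qed.

Lemma Re_sum (I : Type) (s : seq I) (F : I -> R[i]) :
  complex.Re (\sum_(i <- s) F i) = \sum_(i <- s) complex.Re (F i).
Proof. by elim/big_rec2: _ => // i x [a b] _ <-; case: (F i). Qed.

Lemma Im_sum (I : Type) (s : seq I) (F : I -> R[i]) :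
  complex.Im (\sum_(i <- s) F i) = \sum_(i <- s) complex.Im (F i).
Proof. by elim/big_rec2: _ => // i x [a b] _ <-; case: (F i). Qed.

Lemma Re_le_normc x : `|complex.Re x| <= normc x.
Proof. by rewrite -lecR -normrC normc_ge_Re. Qed.

Lemma Im_le_normc x : `|complex.Im x| <= normc x.
Proof.
case: x => a b /=; rewrite -(sqrtr_sqr b) ler_wsqrtr// lerDr.
exact: sqr_ge0.
Qed.

(** For a real family p with |p| <= |f|, the partial sums of p + |f| increase and
    stay bounded, hence converge, and so do those of p.  Apply this to the real and
    imaginary parts of f. *)
Lemma abs_summable_cvg {n : nat} (f : mindex n -> R[i]) (M : R) :
  (forall m, msum m (fun S => normc (f S)) <= M) ->
  exists l : R[i], (fun m => msum m f) @ \oo --> l.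
Proof.
move=> fM; pose A m := msum m (fun S => normc (f S)).
have A0 m : 0 <= A m by rewrite sumr_ge0// => S _; exact: normc_ge0.
have cvgA : cvgn A.
  apply: nondecreasing_is_cvgn; first by apply: msum_homo => S; exact: normc_ge0.
  by exists M => _ [m _ <-]; exact: fM.
have real_cvg (p : mindex n -> R) : (forall S, `|p S| <= normc (f S)) ->
    cvgn (fun m => msum m p).
  move=> pf.
  have cvgAp : cvgn (fun m => msum m (fun S => p S + normc (f S))).
    apply: nondecreasing_is_cvgn.
      apply: msum_homo => S; have := pf S; rewrite ler_norml => /andP[H _].
      by rewrite -lerBlDr sub0r.
    exists (M + M) => _ [m _ <-].
    rewrite (_ : msum m _ = msum m p + A m); last first.
      by rewrite /A /Defs.msum big_split.
    apply: lerD; last exact: fM.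
    apply: le_trans (fM m); apply: ler_sum => S _.
    exact: le_trans (ler_norm _) (pf _).
  apply: cvgP; apply: cvg_trans (cvgB cvgAp cvgA).
  apply: near_eq_cvg; apply: nearW => m.
  by rewrite !fctE /A /Defs.msum big_split/= addrK.
have /real_cvg /cvg_ex[a Ha] : forall S, `|complex.Re (f S)| <= normc (f S).
  by move=> S; exact: Re_le_normc.
have /real_cvg /cvg_ex[b Hb] : forall S, `|complex.Im (f S)| <= normc (f S).
  by move=> S; exact: Im_le_normc.
exists (a +i* b)%C; apply: cvgc_re_im.
  by under eq_cvg do rewrite msumE Re_sum -msumE.
by under eq_cvg do rewrite msumE Im_sum -msumE.
Qed.

End ComplexNorm.

(** * First-order expansions with a multiplicative majorant *)

Section Jets.
Context {R : realType}.
Variables (h : R[i]) (h0 : R).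
Hypotheses (h0_gt0 : 0 < h0) (h_le : normc h <= h0).

(** Here p is the value at h, p0 the value and p1 the derivative at 0 of a function
    of h.  The summands of P stand for the constant, linear and higher parts of a
    majorant evaluated at h0; keeping them apart makes the estimate stable under
    products, which a bound by P alone is not. *)
Definition jet (p p0 p1 : R[i]) (P : R) := exists P0 P1 P2 : R,
  [/\ 0 <= P0, 0 <= P1, 0 <= P2 & P0 + P1 + P2 = P] /\
  [/\ normc p0 <= P0, h0 * normc p1 <= P1 &
      normc (p - p0 - h * p1) <= (normc h / h0) ^+ 2 * P2].

Lemma jet_first p p0 p1 P : jet p p0 p1 P -> h0 * normc p1 <= P.
Proof. by case=> P0 [P1 [P2 [[? ? ? <-] [? ? ?]]]]; lra. Qed.

Lemma jet_second p p0 p1 P : jet p p0 p1 P ->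
  normc (p - p0 - h * p1) <= (normc h / h0) ^+ 2 * P.
Proof.
case=> P0 [P1 [P2 [[P00 P10 P20 <-] [_ _ H]]]]; apply: le_trans H _.
by apply: ler_wpM2l; [exact: sqr_ge0 | lra].
Qed.

Lemma jet_const (a : R[i]) : jet a a 0 (normc a).
Proof.
exists (normc a), 0, 0; rewrite !addr0 normc_ge0; split=> //; split=> //.
  by rewrite Normc.normc0 mulr0.
by rewrite mulr0 subr0 subrr Normc.normc0 mulr0.
Qed.

Lemma jet_affine (w v : R[i]) : jet (w + h * v) w v (normc w + h0 * normc v).
Proof.
exists (normc w), (h0 * normc v), 0; split; split; rewrite ?addr0 ?normc_ge0//.
  by rewrite mulr_ge0 ?normc_ge0// ltW.
by rewrite [w + _]addrC addrK subrr Normc.normc0 mulr0.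
Qed.

(** With remainders rp and rq, the remainder of the product is
    rp q + p0 rq + h p1 rq + h^2 p1 q1, and each term is bounded by a part of the
    product of the majorants. *)
Lemma jetM p p0 p1 P q q0 q1 Q : jet p p0 p1 P -> jet q q0 q1 Q ->
  jet (p * q) (p0 * q0) (p0 * q1 + p1 * q0) (P * Q).
Proof.
move=> [P0 [P1 [P2 [[P00 P10 P20 <-] [p0P p1P rP]]]]].
move=> [Q0 [Q1 [Q2 [[Q00 Q10 Q20 <-] [q0Q q1Q rQ]]]]].
set t := normc h / h0 in rP rQ *.
have t0 : 0 <= t by rewrite divr_ge0 ?normc_ge0// ltW.
have t1 : t <= 1 by rewrite ler_pdivrMr// mul1r.
have t2 : t ^+ 2 <= 1 by rewrite expr_le1.
have hx x X : h0 * normc x <= X -> normc (h * x) <= t * X.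
  move=> xX; rewrite Normc.normcM (le_trans _ (ler_wpM2l t0 xX))//.
  by rewrite mulrA divfK ?gt_eqF.
have hp1 := hx _ _ p1P; have hq1 := hx _ _ q1Q.
set rp := p - p0 - h * p1 in rP; set rq := q - q0 - h * q1 in rQ.
have qQ : normc q <= Q0 + Q1 + Q2.
  have -> : q = q0 + h * q1 + rq by rewrite /rq; ring.
  have H1 := normc_leD (q0 + h * q1) rq; have H2 := normc_leD q0 (h * q1).
  have H3 : t * Q1 <= Q1 by rewrite ler_piMl.
  have H4 : t ^+ 2 * Q2 <= Q2 by rewrite ler_piMl.
  lra.
exists (P0 * Q0), (P0 * Q1 + P1 * Q0),
  (P2 * (Q0 + Q1 + Q2) + P0 * Q2 + P1 * Q2 + P1 * Q1); split; split.
- exact: mulr_ge0.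
- by rewrite addr_ge0 ?mulr_ge0.
- by rewrite !addr_ge0 ?mulr_ge0 ?addr_ge0.
- ring.
- by rewrite Normc.normcM ler_pM ?normc_ge0.
- have H1 : normc (p0 * q1 + p1 * q0) <= normc p0 * normc q1 + normc p1 * normc q0.
    by rewrite (le_trans (normc_leD _ _))// !Normc.normcM.
  have H2 : normc p0 * (h0 * normc q1) <= P0 * Q1.
    by rewrite ler_pM ?mulr_ge0 ?normc_ge0// ltW.
  have H3 : (h0 * normc p1) * normc q0 <= P1 * Q0.
    by rewrite ler_pM ?mulr_ge0 ?normc_ge0// ltW.
  have H4 := ler_wpM2l (ltW h0_gt0) H1.
  by apply: (le_trans H4); lra.
- have -> : p * q - p0 * q0 - h * (p0 * q1 + p1 * q0) =
      rp * q + p0 * rq + (h * p1) * rq + (h * p1) * (h * q1).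
    by rewrite /rp /rq; ring.
  have H1 := normc_leD (rp * q + p0 * rq + (h * p1) * rq) ((h * p1) * (h * q1)).
  have H2 := normc_leD (rp * q + p0 * rq) ((h * p1) * rq).
  have H3 := normc_leD (rp * q) (p0 * rq).
  rewrite Normc.normcM in H1; rewrite [in X in _ <= X]Normc.normcM in H2.
  rewrite !Normc.normcM -!Normc.normcM in H3.
  have K1 : normc rp * normc q <= (t ^+ 2 * P2) * (Q0 + Q1 + Q2).
    by rewrite ler_pM ?normc_ge0.
  have K2 : normc p0 * normc rq <= P0 * (t ^+ 2 * Q2).
    by rewrite ler_pM ?normc_ge0.
  have K3 : normc (h * p1) * normc rq <= (t * P1) * (t ^+ 2 * Q2).
    by rewrite ler_pM ?normc_ge0.
  have K4 : normc (h * p1) * normc (h * q1) <= (t * P1) * (t * Q1).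
    by rewrite ler_pM ?normc_ge0.
  have K5 : (t * P1) * (t ^+ 2 * Q2) <= P1 * (t ^+ 2 * Q2).
    by apply: ler_wpM2r; [rewrite mulr_ge0 ?sqr_ge0 | rewrite ler_piMl].
  have E1 : normc (rp * q) = normc rp * normc q by exact: Normc.normcM.
  have E2 : normc (p0 * rq) = normc p0 * normc rq by exact: Normc.normcM.
  have E3 : normc (h * p1 * rq) = normc (h * p1) * normc rq by exact: Normc.normcM.
  rewrite ?E1 ?E2 ?E3 in H1 H2 H3.
  apply: (le_trans H1); rewrite expr2 in K1 K2 K3 K5 *; lra.
Qed.

Lemma jetX (w v : R[i]) k :
  jet ((w + h * v) ^+ k) (w ^+ k) (v * (k%:R * w ^+ k.-1))
      ((normc w + h0 * normc v) ^+ k).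
Proof.
elim: k => [|k IH].
  by rewrite !expr0 mul0r mulr0; have := jet_const 1; rewrite Normc.normc1.
have := jetM _ _ _ _ _ _ _ _ (jet_affine w v) IH; rewrite -!exprS.
congr jet; case: k {IH} => [|k] /=; first by rewrite expr0; ring.
by rewrite !exprS -[k.+2%:R]natr1; ring.
Qed.

Lemma jet_prod (I : eqType) (s : seq I) (p p0 p1 : I -> R[i]) (P : I -> R) :
  uniq s -> (forall i, jet (p i) (p0 i) (p1 i) (P i)) ->
  jet (\prod_(i <- s) p i) (\prod_(i <- s) p0 i)
      (\sum_(k <- s) p1 k * \prod_(i <- s | i != k) p0 i) (\prod_(i <- s) P i).
Proof.
move=> + H; elim: s => [_|x s IH /= /andP[xs us]].
  by rewrite !big_nil; have := jet_const 1; rewrite Normc.normc1.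
have := jetM _ _ _ _ _ _ _ _ (H x) (IH us); rewrite !big_cons eqxx/=.
congr jet; rewrite addrC; congr (_ * _ + _).
  rewrite [LHS]big_seq [RHS]big_seq_cond; apply: eq_bigl => i.
  by case: (eqVneq i x) => [->|_]; rewrite ?(negbTE xs) ?andbT.
rewrite mulr_sumr [LHS]big_seq [RHS]big_seq; apply: eq_bigr => k ks.
rewrite big_cons ifT; first by ring.
by apply: contraNneq xs => ->.
Qed.

End Jets.

(** * Power series in several variables *)

Section PowerSeries.
Context {R : realType} {n : nat}.
Implicit Types (a z v : 'rV[R[i]]_n) (S T : mindex n) (c : mindex n -> R[i]).
Implicit Types (G : 'rV[R[i]]_n -> R[i]).

(** The partial derivative of the monomial w^S in the k-th variable. *)
Definition dmpow (w : 'I_n -> R[i]) (k : 'I_n) (S : mindex n) : R[i] :=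
  (S k)%:R * w k ^+ (S k).-1 * \prod_(j < n | j != k) w j ^+ S j.

Lemma dmpow_incr w k T : dmpow w k (mincr k T) = (T k).+1%:R * mpow w T.
Proof.
rewrite /dmpow ffunE eqxx addn1 /= -mulrA; congr (_ * _).
rewrite [RHS](bigD1 k)//=; congr (_ * _); apply: eq_bigr => j /negbTE jk.
by rewrite ffunE jk addn0.
Qed.

Lemma dmpow_eq0 w k S : S k = 0%N -> dmpow w k S = 0.
Proof. by rewrite /dmpow => ->; rewrite !mul0r. Qed.

Lemma jet_mpow (h : R[i]) (h0 : R) (w v : 'I_n -> R[i]) S :
  0 < h0 -> normc h <= h0 ->
  jet h h0 (mpow (fun j => w j + h * v j) S) (mpow w S)
    (\sum_(k < n) v k * dmpow w k S)
    (mpow (fun j => normc (w j) + h0 * normc (v j)) S).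
Proof.
move=> h0_gt0 hh0.
have := @jet_prod _ _ _ h0_gt0 hh0 _ (index_enum 'I_n) _ _ _ _
  (index_enum_uniq _) (fun j => jetX _ _ h0_gt0 hh0 (w j) (v j) (S j)).
by congr jet; apply: eq_bigr => k _; rewrite /dmpow -!mulrA.
Qed.

Definition polydisc a (rho : R) : set 'rV[R[i]]_n :=
  [set z | forall j, normc (z 0 j - a 0 j) < rho].

(** Absolute convergence is kept as a bound on partial sums: this is the form that
    termwise differentiation preserves. *)
Definition sums_on a (rho : R) c G := forall z, polydisc a rho z ->
  (exists M : R, forall m,
    msum m (fun S => normc (c S) * mpow (fun j => normc (z 0 j - a 0 j)) S) <= M) /\
  (fun m => msum m (fun S => c S * mpow (fun j => z 0 j - a 0 j) S)) @ \oo --> G z.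

(** The room between z and the boundary of the polydisc pays for the factors s_k
    produced by differentiation. *)
Lemma polydisc_room a rho z v : 0 < rho -> polydisc a rho z ->
  exists2 h0 : R, 0 < h0 &
    forall j, normc (z 0 j - a 0 j) + h0 * normc (v 0 j) < rho.
Proof.
move=> rho0 za; pose m := \big[Num.max/0]_(j < n) normc (z 0 j - a 0 j).
pose V := \sum_(j < n) normc (v 0 j) + 1.
have m_rho : m < rho by apply: bigmax_lt => // j _; exact: za.
have V0 : 0 < V by rewrite ltr_wpDl// sumr_ge0// => j _; exact: normc_ge0.
exists ((rho - m) / V) => [|j]; first by rewrite divr_gt0 ?subr_gt0.
have zm : normc (z 0 j - a 0 j) <= m by apply: le_bigmax_cond.
have vV : normc (v 0 j) < V.
  rewrite /V (bigD1 j)//= -addrA ltrDl ltr_wpDl//.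
  by rewrite sumr_ge0// => i _; exact: normc_ge0.
rewrite mulrAC -ltrBrDl ltr_pdivrMr//.
have : (rho - m) * normc (v 0 j) < (rho - m) * V by rewrite ltr_pM2l// subr_gt0.
move=> /lt_le_trans; apply; apply: ler_wpM2r; [exact: ltW | lra].
Qed.

(** By [jet_mpow], the second-order remainder of (w + h v)^S is at most
    (|h| / h0)^2 (|w| + h0 |v|)^S.  The radii |w| + h0 |v| still lie in the polydisc,
    so these majorants are summable against c. *)
Lemma sums_on_expansion a rho c G z v : 0 < rho -> sums_on a rho c G ->
  polydisc a rho z ->
  exists (D : R[i]) (h0 M : R), [/\ 0 < h0,
    forall m, msum m (fun S => normc (c S *
      \sum_(k < n) v 0 k * dmpow (fun j => z 0 j - a 0 j) k S)) <= M,
    (fun m => msum m (fun S => c S *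
      \sum_(k < n) v 0 k * dmpow (fun j => z 0 j - a 0 j) k S)) @ \oo --> D &
    forall h, normc h <= h0 ->
      normc (G (z + h *: v) - G z - h * D) <= M * normc h ^+ 2].
Proof.
move=> rho0 cG za; have [h0 h0_gt0 room] := polydisc_room _ _ _ v rho0 za.
set w := fun j => z 0 j - a 0 j.
pose z1 : 'rV[R[i]]_n := \row_j (a 0 j + (normc (w j) + h0 * normc (v 0 j))%:C).
have z1w j : normc (z1 0 j - a 0 j) = normc (w j) + h0 * normc (v 0 j).
  rewrite mxE [a 0 j + _]addrC addrK normc_real ger0_norm//.
  by rewrite addr_ge0 ?mulr_ge0 ?normc_ge0// ltW.
have [[M HM] _] : (exists M : R, forall m, msum m (fun S => normc (c S) *
    mpow (fun j => normc (z1 0 j - a 0 j)) S) <= M) /\ True.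
  by have [|+ _] := cG z1; [move=> j; rewrite z1w; exact: room | split].
pose P S := mpow (fun j => normc (w j) + h0 * normc (v 0 j)) S.
have {}HM m : msum m (fun S => normc (c S) * P S) <= M.
  apply: le_trans (HM m); rewrite le_eqVlt; apply/orP; left; apply/eqP.
  apply: eq_bigr => S _; congr (_ * _); apply: eq_bigr => j _; congr (_ ^+ _).
  by rewrite z1w.
pose d S := \sum_(k < n) v 0 k * dmpow w k S.
have jetS h S : normc h <= h0 ->
    jet h h0 (mpow (fun j => w j + h * v 0 j) S) (mpow w S) (d S) (P S).
  by move=> hh0; exact: jet_mpow.
have h00 : normc (0 : R[i]) <= h0 by rewrite Normc.normc0 ltW.
have dP m : msum m (fun S => normc (c S * d S)) <= h0^-1 * M.
  apply: le_trans (ler_wpM2l _ (HM m)); last by rewrite invr_ge0 ltW.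
  rewrite /Defs.msum mulr_sumr; apply: ler_sum => S _.
  rewrite Normc.normcM mulrCA ler_wpM2l ?normc_ge0//.
  by rewrite ler_pdivlMl//; exact: jet_first (jetS _ _ h00).
have [D HD] := abs_summable_cvg _ _ dP.
(* the two bounds come from the linear and the second-order terms *)
exists D, h0, (Num.max (h0^-1 * M) (M / h0 ^+ 2)); split => //.
  by move=> m; rewrite le_max dP.
move=> h hh0; apply: (@le_trans _ _ (M / h0 ^+ 2 * normc h ^+ 2)); last first.
  by rewrite ler_wpM2r ?sqr_ge0// le_max lexx orbT.
have zh : polydisc a rho (z + h *: v).
  move=> j; apply: le_lt_trans (room j).
  rewrite !mxE addrAC (le_trans (normc_leD _ _))// lerD2l Normc.normcM.
  by rewrite ler_wpM2r ?normc_ge0.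
have [_ cv1] := cG _ zh; have [_ cv0] := cG _ za.
apply: (cvgc_le_norm _ _ _ (cvgB (cvgB cv1 cv0) (cvgM (cvg_cst h) HD))).
apply: nearW => m.
change (normc (msum m (fun S => c S * mpow (fun j => (z + h *: v) 0 j - a 0 j) S)
  - msum m (fun S => c S * mpow (fun j => z 0 j - a 0 j) S)
  - h * msum m (fun S => c S * d S)) <= M / h0 ^+ 2 * normc h ^+ 2).
rewrite /Defs.msum mulr_sumr -!sumrB.
rewrite (le_trans (normc_sum _ _ _ _))//.
have -> : M / h0 ^+ 2 * normc h ^+ 2 = (normc h / h0) ^+ 2 * M.
  by rewrite expr_div_n; ring.
apply: le_trans (ler_wpM2l (sqr_ge0 _) (HM m)).
rewrite mulr_sumr; apply: ler_sum => S _.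
rewrite (_ : mpow _ _ = mpow (fun j => w j + h * v 0 j) (mindex_of S)); last first.
  by apply: eq_bigr => j _; rewrite !mxE addrAC.
rewrite [h * (c _ * _)]mulrCA -!mulrBr Normc.normcM mulrCA ler_wpM2l ?normc_ge0//.
exact: jet_second (jetS _ _ hh0).
Qed.

End PowerSeries.

(** * Termwise differentiation *)

Lemma cvg_ext {T : Type} {U : topologicalType} (G : set_system T) (f g : T -> U)
  (l : U) : f =1 g -> f @ G --> l -> g @ G --> l.
Proof. by move=> /funext ->. Qed.

Section Derivatives.
Context {R : realType} {n : nat}.
Implicit Types (a z v : 'rV[R[i]]_n) (S T : mindex n) (c : mindex n -> R[i]).
Implicit Types (F G : 'rV[R[i]]_n -> R[i]).

Lemma derive_expansion G z v (D : R[i]) (h0 M : R) : 0 < h0 ->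
  (forall h, normc h <= h0 ->
    normc (G (z + h *: v) - G z - h * D) <= M * normc h ^+ 2) ->
  'D_v G z = D.
Proof.
move=> h0_gt0 H; apply: cvg_lim; first exact: norm_hausdorff.
apply/cvgcP => e e0; pose e1 := Num.min h0 (e / (`|M| + 1)).
have M1 : 0 < `|M| + 1 by rewrite ltr_wpDl.
have e10 : 0 < e1 by rewrite lt_min h0_gt0 divr_gt0.
have e1C : 0 < e1%:C :> R[i] by rewrite ltcR.
apply: filterS2 (dnbhs0_lt e1C) (nbhs_dnbhs_neq (0 : R[i])) => h.
rewrite normrC ltcR lt_min => /andP[hh0 he] hn0.
have nh0 : 0 < normc h.
  by rewrite lt_neqAle normc_ge0 andbT eq_sym; apply: contra_neq hn0 => /Normc.eq0_normc.
have -> : D - h^-1 *: ((G \o shift z) (h *: v) - G z) =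
    - (h^-1 * (G (z + h *: v) - G z - h * D)).
  rewrite /= [h *: v + z]addrC -[_ *: _]/(h^-1 * _) -[D in LHS](mulKf hn0).
  by ring.
rewrite normc_opp Normc.normcM Normc.normcV ltr_pdivrMl//.
rewrite (le_lt_trans (H _ (ltW hh0)))// expr2 mulrA mulrC ltr_pM2l//.
rewrite (@le_lt_trans _ _ (`|M| * normc h)) ?ler_wpM2r ?normc_ge0 ?ler_norm//.
move: he; rewrite ltr_pdivlMr// mulrDr mulr1 mulrC; lra.
Qed.

Lemma sum_delta (f : 'I_n -> R[i]) k :
  \sum_(j < n) (delta_mx 0 k : 'rV[R[i]]_n) 0 j * f j = f k.
Proof.
rewrite (bigD1 k)//= mxE !eqxx mul1r big1 ?addr0// => j /negbTE jk.
by rewrite mxE jk andbF mul0r.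
Qed.

Lemma sums_on_partial a rho c G z k : 0 < rho -> sums_on a rho c G ->
  polydisc a rho z ->
  (exists M : R, forall m,
    msum m (fun S => normc (c S * dmpow (fun j => z 0 j - a 0 j) k S)) <= M) /\
  (fun m => msum m (fun S => c S * dmpow (fun j => z 0 j - a 0 j) k S)) @ \oo -->
    'D_(delta_mx 0 k) G z.
Proof.
move=> rho0 cG za.
have [D [h0 [M [h0_gt0 HM HD Hh]]]] := sums_on_expansion _ _ _ _ _ (delta_mx 0 k) rho0 cG za.
rewrite (derive_expansion _ _ _ _ _ _ h0_gt0 Hh); split.
  by exists M => m; have := HM m; under eq_fun do rewrite sum_delta.
apply: cvg_ext HD => m.
by congr Defs.msum; apply/funext => S; rewrite sum_delta.
Qed.

(** Each term of the differentiated series is linear in v, hence so is its sum. *)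
Lemma sums_on_differentiable a rho c G z v : 0 < rho -> sums_on a rho c G ->
  polydisc a rho z ->
  exists h0 M : R, 0 < h0 /\ forall h, normc h <= h0 ->
    normc (G (z + h *: v) - G z
           - h * \sum_(k < n) v 0 k * 'D_(delta_mx 0 k) G z) <= M * normc h ^+ 2.
Proof.
move=> rho0 cG za.
have [D [h0 [M [h0_gt0 _ HD Hh]]]] := sums_on_expansion _ _ _ _ _ v rho0 cG za.
exists h0, M; split => //; suff -> : \sum_(k < n) v 0 k * 'D_(delta_mx 0 k) G z = D by [].
have cvS : (fun m => \sum_(k < n) v 0 k *
    msum m (fun S => c S * dmpow (fun j => z 0 j - a 0 j) k S)) @ \oo -->
    \sum_(k < n) v 0 k * 'D_(delta_mx 0 k) G z.
  apply: cvg_big => [|k _]; first exact: add_continuous.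
  apply: cvgM; first exact: cvg_cst.
  by have [_] := sums_on_partial _ _ _ _ _ k rho0 cG za.
apply: (cvg_unique _ cvS); first exact: norm_hausdorff.
apply: cvg_ext HD => m.
rewrite /Defs.msum; under [RHS]eq_bigr do rewrite mulr_sumr.
rewrite [RHS]exchange_big/=; apply: eq_bigr => S _; rewrite mulr_sumr.
by apply: eq_bigr => k _; rewrite mulrCA.
Qed.

Lemma normc_mpow (w : 'I_n -> R[i]) S :
  normc (mpow w S) = mpow (fun j => normc (w j)) S.
Proof. by rewrite /mpow normc_prod; apply: eq_bigr => j _; rewrite normcX. Qed.

(** The coefficients of the k-th partial derivative of a power series. *)
Definition cshift k c : mindex n -> R[i] := fun T => (T k).+1%:R * c (mincr k T).

(** Symmetry of second derivatives, on coefficients. *)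
Lemma cshiftC k l c : cshift k (cshift l c) = cshift l (cshift k c).
Proof.
apply/funext => T; rewrite /cshift !ffunE.
have -> : mincr k (mincr l T) = mincr l (mincr k T).
  by apply/ffunP => j; rewrite !ffunE addnAC.
by case: (eqVneq l k) => [->//|_]; rewrite !addn0 mulrCA.
Qed.

(** The polydisc does not shrink, so that the step can be iterated. *)
Lemma sums_on_derive a rho c G k : 0 < rho -> sums_on a rho c G ->
  sums_on a rho (cshift k c) ('D_(delta_mx 0 k) G).
Proof.
move=> rho0 cG z za; have [[M HM] HD] := sums_on_partial _ _ _ _ _ k rho0 cG za.
set w := fun j => z 0 j - a 0 j in HM HD.
have E S : cshift k c S * mpow w S = c (mincr k S) * dmpow w k (mincr k S).
  by rewrite dmpow_incr /cshift mulrCA mulrA.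
split.
  exists M => m; apply: le_trans (HM m.+1).
  rewrite -(msum_incr m k (fun S => normc (c S * dmpow w k S))); last first.
    by move=> S Sk; rewrite dmpow_eq0// mulr0 Normc.normc0.
  apply: ler_sum => S _; by rewrite -E [in leRHS]Normc.normcM normc_mpow.
have : (fun m => msum m.+1 (fun S => c S * dmpow w k S)) @ \oo --> 'D_(delta_mx 0 k) G z.
  by move: HD; rewrite -(cvg_shiftS (fun m => msum m (fun S => c S * dmpow w k S))).
apply: cvg_ext => m.
rewrite -(msum_incr m k); last by move=> S Sk; rewrite dmpow_eq0// mulr0.
by congr Defs.msum; apply/funext => S; rewrite E.
Qed.

Definition cderiv S c : mindex n -> R[i] :=
  foldr (fun k d => iter (S k) (cshift k) d) c (enum 'I_n).

Lemma sums_on_mderiv a rho c F S : 0 < rho -> sums_on a rho c F ->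
  sums_on a rho (cderiv S c) (mderiv S F).
Proof.
move=> rho0 cF; rewrite /cderiv /mderiv.
elim: (enum 'I_n) => [|k s IH]; first exact: cF.
rewrite ![foldr _ _ (k :: s)]/(foldr _ _ _).
elim: (S k) => [|m IHm]; first exact: IH.
by rewrite !iterS; exact: sums_on_derive.
Qed.

(** [cderiv], like [mderiv], takes the derivatives in a fixed order of the
    variables; [cshiftC] moves the additional one to the front. *)
Lemma cderiv_incr k S c : cderiv (mincr k S) c = cshift k (cderiv S c).
Proof.
rewrite /cderiv; have := mem_enum 'I_n k; rewrite inE.
have iterC m j d : iter m (cshift j) (cshift k d) = cshift k (iter m (cshift j) d).
  by elim: m => //= m ->; rewrite cshiftC.
have : forall s : seq 'I_n, k \notin s ->
    foldr (fun j d => iter (mincr k S j) (cshift j) d) c s =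
    foldr (fun j d => iter (S j) (cshift j) d) c s.
  elim=> //= j s IH; rewrite inE negb_or => /andP[kj ks].
  by rewrite IH// ffunE eq_sym (negbTE kj) addn0.
move=> foldN; have := enum_uniq 'I_n; elim: (enum 'I_n) => //= j s IH /andP[js us].
rewrite inE; have [ekj _|kj /= ks] := eqVneq k j.
  by subst j; rewrite foldN// ffunE eqxx addn1 iterS.
by rewrite IH// iterC ffunE eq_sym (negbTE kj) addn0.
Qed.

Lemma sums_on_unique a rho c F G z : sums_on a rho c F -> sums_on a rho c G ->
  polydisc a rho z -> F z = G z.
Proof.
move=> cF cG za; have [_ HF] := cF z za; have [_ HG] := cG z za.
by apply: (cvg_unique _ HF HG); exact: norm_hausdorff.
Qed.

Lemma polydisc_center a (rho : R) : 0 < rho -> polydisc a rho a.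
Proof. by move=> rho0 j; rewrite subrr Normc.normc0. Qed.

Lemma analytic_sums_on F a : analytic_on_ball F -> cball a ->
  exists c rho, 0 < rho /\ sums_on a rho c F.
Proof.
move=> HF /HF[c [rho [rho0 cF]]]; exists c, rho; split => // z za.
have [Hoo ?] := cF z za; split => //; apply: esum_msum_bounded => // S.
rewrite mulr_ge0 ?normc_ge0// prodr_ge0// => j _.
by rewrite exprn_ge0 ?normc_ge0.
Qed.

(** Both sides are sums of the same local power series by [cderiv_incr]. *)
Lemma derive_mderiv F a S k : analytic_on_ball F -> cball a ->
  'D_(delta_mx 0 k) (mderiv S F) a = mderiv (mincr k S) F a.
Proof.
move=> HF aB; have [c [rho [rho0 cF]]] := analytic_sums_on _ _ HF aB.
apply: (sums_on_unique a rho (cderiv (mincr k S) c)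
  ('D_(delta_mx 0 k) (mderiv S F)) (mderiv (mincr k S) F)).
- rewrite cderiv_incr.
  exact: sums_on_derive _ _ _ _ k rho0 (sums_on_mderiv _ _ _ _ S rho0 cF).
- exact: sums_on_mderiv _ _ _ _ (mincr k S) rho0 cF.
- exact: polydisc_center.
Qed.

Lemma mderiv_differentiable F a v S : analytic_on_ball F -> cball a ->
  exists h0 M : R, 0 < h0 /\ forall h, normc h <= h0 ->
    normc (mderiv S F (a + h *: v) - mderiv S F a
           - h * \sum_(k < n) v 0 k * mderiv (mincr k S) F a) <= M * normc h ^+ 2.
Proof.
move=> HF aB; have [c [rho [rho0 cF]]] := analytic_sums_on _ _ HF aB.
under eq_bigr do rewrite -derive_mderiv//.
exact: sums_on_differentiable _ _ _ _ _ v rho0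
  (sums_on_mderiv _ _ _ _ S rho0 cF) (polydisc_center a rho rho0).
Qed.

End Derivatives.

(** * Comparison by upper right Dini derivatives *)

Section Comparison.
Context {R : realType}.
Implicit Types (b t s : R) (phi Y : R -> R).

Lemma at_rightP t (P : set R) : (\forall x \near t^'+, P x) <->
  exists2 d, 0 < d & forall x, t < x < t + d -> P x.
Proof.
rewrite /at_right near_withinE; split.
  move=> /nbhs_ballP[d /= d0 H]; exists d => // x /andP[tx xd].
  by apply: H => //; rewrite /ball/= ltr_distlC; apply/andP; split; lra.
move=> [d d0 H]; apply/nbhs_ballP; exists d => //= x.
by rewrite /ball/= ltr_distlC => /andP[_ xd] tx; apply: H; rewrite tx.
Qed.

Lemma at_leftP t (P : set R) : (\forall x \near t^'-, P x) <->
  exists2 d, 0 < d & forall x, t - d < x < t -> P x.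
Proof.
rewrite /at_left near_withinE; split.
  move=> /nbhs_ballP[d /= d0 H]; exists d => // x /andP[tx xd].
  by apply: H => //; rewrite /ball/= ltr_distlC; apply/andP; split; lra.
move=> [d d0 H]; apply/nbhs_ballP; exists d => //= x.
by rewrite /ball/= ltr_distlC => /andP[xd _] tx; apply: H; rewrite tx xd.
Qed.

(** Let T be the supremum of the t such that P holds on [0, t].  Then P T holds by
    the passage to left limits, and T < b would contradict the step to the right. *)
Lemma real_induction b (P : R -> Prop) : 0 <= b -> P 0 ->
  (forall t, 0 <= t < b -> P t -> \forall s \near t^'+, P s) ->
  (forall t, 0 < t <= b -> (forall s, 0 <= s < t -> P s) -> P t) ->
  P b.
Proof.
move=> b0 P0 Pright Pleft.
pose A := [set t | 0 <= t <= b /\ forall s, 0 <= s <= t -> P s].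
have A0 : A 0.
  by split=> [|s s0]; [rewrite lexx | rewrite (_ : s = 0)//; apply/eqP; rewrite eq_le andbC].
have supA : has_sup A by split; [exists 0 | exists b => t [/andP[]]].
pose T := sup A.
have T0 : 0 <= T by apply: ub_le_sup => //; case: supA.
have Tb : T <= b by apply: ge_sup => [|t [/andP[]]]//; exists 0.
have PltT s : 0 <= s < T -> P s.
  move=> /andP[s0 sT]; have [t At st] := sup_gt (supA.1) sT.
  by apply: (At.2); rewrite s0 ltW.
have PT : P T.
  by have := T0; rewrite le_eqVlt => /predU1P[<-//|T_gt0]; apply: Pleft => //; rewrite T_gt0.
have := Tb; rewrite le_eqVlt => /predU1P[<-//|T_lt].
have /at_rightP[d d0 Hd] : \forall s \near T^'+, P s.
  by apply: Pright => //; rewrite T0.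
pose t := Num.min b (T + d / 2).
have Tt : T < t by rewrite lt_min T_lt ltrDl divr_gt0.
suff /(ub_le_sup supA.2) : A t by rewrite leNgt -/T Tt.
split=> [|s /andP[s0 st]].
  by rewrite (le_trans T0 (ltW Tt)) ge_min lexx.
have [sT|Ts|->//] := ltgtP s T; first by apply: PltT; rewrite s0.
apply: Hd; rewrite Ts/=; move: st; rewrite le_min => /andP[_]; lra.
Qed.

Lemma within_right b t phi : {within `[0, b], continuous phi} -> 0 <= t < b ->
  phi s @[s --> t^'+] --> phi t.
Proof.
move=> cphi /andP[t0 tb]; have b0 := le_lt_trans t0 tb.
have [cin c0 _] := (continuous_within_itvP _ b0).1 cphi.
move: t0; rewrite le_eqVlt => /predU1P[<-//|t0].
by apply: cvg_at_right_filter; apply: cin; rewrite in_itv/= t0 tb.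
Qed.

Lemma integral_ge_cst t s phi (c : R) : t <= s ->
  lebesgue_measure.-integrable `]t, s] (EFin \o phi) ->
  (forall x, t < x <= s -> c <= phi x) ->
  (s - t) * c <= \int[lebesgue_measure]_(x in `]t, s]) phi x.
Proof.
move=> ts iphi cphi; have mI : measurable `]t, s] by exact: measurable_itv.
have -> : (s - t) * c = \int[lebesgue_measure]_(x in `]t, s]) c.
  rewrite Rintegral_cst//= lebesgue_measure_itv/= lte_fin.
  move: ts; rewrite le_eqVlt => /predU1P[->|->]; first by rewrite ltxx subrr mulr0 mul0r.
  by rewrite mulrC.
apply: le_Rintegral => //.
have ts_sub : [set` `]t, s]] `<=` [set` `[t, s]] by apply: subset_itvr; rewrite bnd_simp.
apply: (@integrableS _ _ R lebesgue_measure `[t, s]%classic `]t, s]%classic) => //.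
apply: continuous_compact_integrable.
  exact: segment_compact.
by apply: continuous_subspaceT => x; exact: cst_continuous.
Qed.

(** For e > 0, the bound Y t <= Y 0 + int_0^t phi + 2 e t propagates to the right,
    because the integral grows at a rate of at least phi t - e near t.  It passes to
    limits from the left, because the integral is monotone.  Conclude by
    [real_induction] and let e tend to 0. *)
Lemma dini_le_integral b Y phi : 0 <= b ->
  {within `[0, b], continuous phi} -> (forall t, 0 <= t <= b -> 0 <= phi t) ->
  (forall t, 0 < t <= b -> Y s @[s --> t^'-] --> Y t) ->
  (forall t e, 0 <= t < b -> 0 < e ->
    \forall s \near t^'+, Y s <= Y t + (s - t) * (phi t + e)) ->
  Y b <= Y 0 + \int[lebesgue_measure]_(x in `[0, b]) phi x.
Proof.
move=> b0 cphi phi0 Yleft Yright.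
pose Phi t := \int[lebesgue_measure]_(x in `[0, t]) phi x.
have iphi : lebesgue_measure.-integrable `[0, b] (EFin \o phi).
  by apply: continuous_compact_integrable => //; exact: segment_compact.
have iphiS (I : interval R) : [set` I] `<=` `[0, b] ->
    lebesgue_measure.-integrable [set` I] (EFin \o phi).
  by move=> Ib; apply: integrableS iphi.
have PhiB t s : 0 <= t -> t <= s -> s <= b ->
    Phi s - Phi t = \int[lebesgue_measure]_(x in `]t, s]) phi x.
  move=> t0 ts sb; rewrite /Phi Rintegral_itvB ?bnd_simp//.
  by apply: iphiS; apply: subset_itvl; rewrite bnd_simp.
have ioc t s : 0 <= t -> s <= b ->
    lebesgue_measure.-integrable `]t, s] (EFin \o phi).
  move=> t0 sb; apply: iphiS => x /=; rewrite !in_itv/= => /andP[tx xs].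
  by rewrite (le_trans t0 (ltW tx)) (le_trans xs sb).
have Phi_le t s : 0 <= t -> t <= s -> s <= b -> Phi t <= Phi s.
  move=> t0 ts sb; rewrite -subr_ge0 PhiB//; apply: Rintegral_ge0 => x /=.
  by rewrite in_itv/= => /andP[tx xs]; apply: phi0; rewrite (le_trans t0 (ltW tx)) (le_trans xs sb).
(* 2 e b <= e0, also for b = 0 *)
apply/ler_addgt0Pr => e0 e0_gt0; pose e := e0 / (2 * (b + 1)).
have b1 : 0 < b + 1 by rewrite ltr_wpDl.
have e_gt0 : 0 < e by rewrite divr_gt0// mulr_gt0.
have : Y b <= Y 0 + Phi b + 2 * e * b.
  apply: (@real_induction b (fun t => Y t <= Y 0 + Phi t + 2 * e * t)) => //.
  - by rewrite mulr0 addr0 /Phi set_itv1 Rintegral_set1 addr0.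
  - move=> t tb Pt; have [t0 t_lt] := andP tb.
    have [d1 d10 H1] := (at_rightP _ _).1 (Yright t e tb e_gt0).
    have /cvgrPdist_lt/(_ _ e_gt0)/at_rightP[d2 d20 H2] := within_right _ _ _ cphi tb.
    apply/at_rightP; exists (Num.min (Num.min d1 d2) (b - t)).
      by rewrite !lt_min d10 d20 subr_gt0.
    move=> s /andP[ts]; rewrite -ltrBlDl !lt_min -!andbA => /and3P[sd1 sd2 sb].
    have sle : s <= b by lra.
    have Ys : Y s <= Y t + (s - t) * (phi t + e) by apply: H1; rewrite ts/=; lra.
    have : (s - t) * (phi t - e) <= Phi s - Phi t.
      rewrite PhiB ?(ltW ts)//; apply: integral_ge_cst; [exact: ltW|exact: ioc|].
      move=> x /andP[tx xs]; have : `|phi t - phi x| < e by apply: H2; rewrite tx/=; lra.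
      by rewrite ltr_norml => /andP[_]; lra.
    lra.
  - move=> t tb Ps; have [t0 t_le] := andP tb.
    apply/ler_addgt0Pr => d d0.
    have /cvgrPdist_lt/(_ _ d0)/at_leftP[d1 d10 Hd] := Yleft t tb.
    pose d2 := Num.min d1 t; pose s := t - d2 / 2.
    have d2_gt0 : 0 < d2 by rewrite lt_min d10.
    have [d21 d2t] : d2 <= d1 /\ d2 <= t by rewrite /d2 !ge_min !lexx orbT.
    have s0 : 0 <= s by rewrite /s; lra.
    have st : s < t by rewrite /s; lra.
    have Hs1 : `|Y t - Y s| < d by apply: Hd; rewrite st andbT /s; lra.
    have := Ps s; rewrite s0 st => /(_ isT) Hs.
    have PP := Phi_le s t s0 (ltW st) t_le.
    have : 2 * e * s <= 2 * e * t by rewrite ler_wpM2l ?ltW// mulr_gt0.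
    by move: Hs1; rewrite ltr_norml => /andP[_]; lra.
move=> /le_trans; apply; rewrite lerD2l /e.
rewrite (_ : 2 * (e0 / (2 * (b + 1))) * b = e0 * (b / (b + 1))); last first.
  by field; rewrite gt_eqF.
by rewrite ler_piMr ?ltW// ltr_pdivrMr// mul1r ltrDl.
Qed.

End Comparison.

(** * First-order expansions on a segment *)

Section FirstOrder.
Context {R : realType}.

(** Clearing the denominator makes the condition trivial at h = 0, so that no
    punctured neighbourhood is left. *)
Lemma dquot_withinP {V : normedModType R} (D : set V) (f : V -> R) (x v : V) l :
  dquot_within D f x v --> l <->
  forall e, 0 < e -> exists2 d, 0 < d & forall h, `|h| < d -> D (x + h *: v) ->
    `|f (x + h *: v) - f x - h * l| <= e * `|h|.
Proof.
rewrite /dquot_within; split=> [/cvgrPdist_le H e e0|H].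
  have := H e e0; rewrite near_withinE near_withinE => /nbhs_ballP[d /= d0 Hd].
  exists d => // h hd Dh; have [->|hn0] := eqVneq h 0.
    by rewrite scale0r addr0 mul0r subr0 subrr normr0 mulr0.
  have := Hd h; rewrite /ball/= sub0r normrN => /(_ hd hn0 Dh) Hh.
  have -> : f (x + h *: v) - f x - h * l =
      - (h * (l - h^-1 * (f (x + h *: v) - f x))) by field.
  by rewrite normrN normrM mulrC ler_wpM2r.
apply/cvgrPdist_le => e e0; have [d d0 Hd] := H e e0.
rewrite near_withinE near_withinE; apply/nbhs_ballP; exists d => //= h.
rewrite /ball/= sub0r normrN => hd hn0 Dh; have := Hd h hd Dh.
have -> : f (x + h *: v) - f x - h * l =
    - (h * (l - h^-1 * (f (x + h *: v) - f x))) by field.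
by rewrite normrN normrM mulrC ler_pM2r// normr_gt0.
Qed.

Lemma derive_within_eq {V : normedModType R} (D : set V) (f : V -> R) (x v : V) l :
  (forall d, 0 < d -> exists2 h, 0 < h < d & D (x + h *: v)) ->
  dquot_within D f x v --> l -> derive_within D f x v = l.
Proof.
move=> accum Hl; apply: cvg_lim Hl => //.
apply: Build_ProperFilter_ex => // P HP.
have /nbhs_ballP[d /= d0 Hd] :
  nbhs (0 : R) [set h | h != 0 -> D (x + h *: v) -> P h] := HP.
have [h /andP[h0 hd] Dh] := accum d d0; exists h.
by apply: Hd => //; [rewrite /ball/= sub0r normrN gtr0_norm | rewrite gt_eqF].
Qed.

(** Differentiability on [0, c] with derivative dpsi, one-sided at both ends because
    only increments inside the segment are tested. *)
Definition first_order (c : R) (psi dpsi : R -> R) := forall x, 0 <= x <= c ->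
  forall e, 0 < e -> exists2 d, 0 < d & forall h, `|h| < d -> 0 <= x + h <= c ->
    `|psi (x + h) - psi x - h * dpsi x| <= e * `|h|.

Lemma first_order_continuous (c : R) (psi dpsi : R -> R) :
  first_order c psi dpsi -> {within `[0, c], continuous psi}.
Proof.
move=> Hpsi; apply/subspace_continuousP => x; rewrite /= in_itv/= => xc.
have [d d0 Hd] := Hpsi x xc 1 ltr01.
apply/cvgrPdist_lt => e e0; rewrite near_withinE; apply/nbhs_ballP.
pose K := `|dpsi x| + 1; have K0 : 0 < K by rewrite ltr_wpDl.
exists (Num.min d (e / K)); first by rewrite /= lt_min d0 divr_gt0.
move=> y; rewrite /ball/= distrC lt_min ltr_pdivlMr// => /andP[yd ye].
rewrite in_itv/= => yc; have := Hd (y - x) yd; rewrite subrKC => /(_ yc) H.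
change (`|psi x - psi y| < e); apply: le_lt_trans ye; rewrite [leLHS]distrC.
rewrite -[psi y - psi x](subrK ((y - x) * dpsi x)) (le_trans (ler_normD _ _))//.
by rewrite normrM /K mulrDr mulr1 addrC lerD2l -[leRHS]mul1r.
Qed.

(** The bound with slope e + eta propagates by [real_induction], also from the
    endpoint 0 where the derivative is one-sided; then eta tends to 0. *)
Lemma mean_value_le (c : R) (psi dpsi : R -> R) (g e : R) : 0 <= c ->
  first_order c psi dpsi ->
  (forall x, 0 <= x <= c -> `|dpsi x - g| <= e) ->
  `|psi c - psi 0 - c * g| <= e * c.
Proof.
move=> c0 Hpsi Hg; apply/ler_addgt0Pr => eta0 eta0_gt0.
pose eta := eta0 / (c + 1); have c1 : 0 < c + 1 by rewrite ltr_wpDl.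
have eta_gt0 : 0 < eta by rewrite divr_gt0.
suff H : `|psi c - psi 0 - c * g| <= (e + eta) * c.
  apply: le_trans H _; rewrite mulrDl lerD2l /eta mulrAC ler_pdivrMr//.
  by rewrite ler_pM2l// lerDl.
apply: (@real_induction _ c (fun t => `|psi t - psi 0 - t * g| <= (e + eta) * t)) => //.
- by rewrite subrr mul0r subrr normr0 mulr0.
- move=> t /andP[t0 tc] Ht.
  have tI : 0 <= t <= c by rewrite t0 ltW.
  have [d d0 Hd] := Hpsi t tI eta eta_gt0; have gt := Hg t tI.
  apply/at_rightP; exists (Num.min d (c - t)); first by rewrite lt_min d0 subr_gt0.
  move=> s /andP[ts]; rewrite -ltrBlDl lt_min => /andP[sd sc].
  have := Hd (s - t); rewrite subrKC gtr0_norm ?subr_gt0// sd => /(_ isT).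
  move=> /(_ ltac:(lra)) Hs.
  have -> : psi s - psi 0 - s * g = (psi t - psi 0 - t * g) +
    (psi s - psi t - (s - t) * dpsi t) + (s - t) * (dpsi t - g) by ring.
  rewrite (le_trans (ler_normD _ _))//.
  have := ler_normD (psi t - psi 0 - t * g) (psi s - psi t - (s - t) * dpsi t).
  have : `|(s - t) * (dpsi t - g)| <= (s - t) * e.
    by rewrite normrM gtr0_norm ?subr_gt0// ler_pM2l ?subr_gt0.
  lra.
- move=> t /andP[t0 tc] Ht; apply/ler_addgt0Pr => d d_gt0.
  have tI : 0 <= t <= c by rewrite tc ltW.
  have [d1 d10 Hd] := Hpsi t tI 1 ltr01.
  pose K := `|dpsi t| + 1 + `|g| + `|e + eta|.
  have K0 : 0 < K + 1 by rewrite /K !(ltr_wpDl, addr_ge0).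
  pose d2 := Num.min (Num.min d1 t) (d / (K + 1)).
  have d20 : 0 < d2 by rewrite !lt_min d10 t0 divr_gt0.
  have [d2d1 d2t d2K] : [/\ d2 <= d1, d2 <= t & d2 <= d / (K + 1)].
    by split; rewrite /d2 !ge_min lexx ?orbT.
  move: d2K; rewrite ler_pdivlMr// => d2K.
  pose s := t - d2 / 2; have s_t : 0 <= s < t by rewrite /s; lra.
  have Hs := Ht s s_t.
  have := Hd (- (d2 / 2)); rewrite normrN gtr0_norm ?divr_gt0// -/s.
  move=> /(_ ltac:(lra) ltac:(rewrite /s; lra)) Hs2.
  have -> : psi t - psi 0 - t * g = (psi s - psi 0 - s * g) -
    (psi s - psi t - - (d2 / 2) * dpsi t) + (d2 / 2) * (dpsi t - g).
    by rewrite /s; ring.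
  rewrite (le_trans (ler_normD _ _))//.
  have := ler_normB (psi s - psi 0 - s * g) (psi s - psi t - - (d2 / 2) * dpsi t).
  have : `|(d2 / 2) * (dpsi t - g)| <= (d2 / 2) * (`|dpsi t| + `|g|).
    by rewrite normrM gtr0_norm ?divr_gt0// ler_pM2l ?divr_gt0// ler_normB.
  have : (e + eta) * s <= (e + eta) * t + `|e + eta| * (d2 / 2).
    have : - (e + eta) * (d2 / 2) <= `|e + eta| * (d2 / 2).
      by rewrite ler_pM2r ?divr_gt0// -normrN ler_norm.
    by rewrite /s; lra.
  rewrite /K in d2K; lra.
Qed.

End FirstOrder.

(** * Functions with continuous partial derivatives in the radii *)

Section Radii.
Context {R : realType} {n : nat}.
Implicit Types (p q r w : 'rV[R]_n) (f : 'rV[R]_n -> R) (G : 'I_n -> 'rV[R]_n -> R).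

Lemma enormZ (a : R) r : 0 <= a -> enorm (a *: r) = a * enorm r.
Proof.
move=> a0; rewrite /enorm -[a in RHS]ger0_norm// -sqrtr_sqr -sqrtrM ?sqr_ge0//.
by congr Num.sqrt; rewrite mulr_sumr; apply: eq_bigr => j _; rewrite mxE exprMn.
Qed.

Lemma enorm_ge0 r : 0 <= enorm r.
Proof. exact: sqrtr_ge0. Qed.

Lemma ler_enorm p q : (forall j, 0 <= p 0 j <= q 0 j) -> enorm p <= enorm q.
Proof.
move=> pq; apply: ler_wsqrtr; apply: ler_sum => j _; have /andP[p0 pj] := pq j.
by rewrite !expr2 ler_pM.
Qed.

Lemma ler_coord_enorm r j : `|r 0 j| <= enorm r.
Proof.
rewrite -sqrtr_sqr; apply: ler_wsqrtr; rewrite (bigD1 j)//= lerDl.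
by apply: sumr_ge0 => i _; exact: sqr_ge0.
Qed.

Lemma radii_le p q : (forall j, 0 <= p 0 j <= q 0 j) -> radii q -> radii p.
Proof.
move=> pq [q0 q1]; split=> [j|]; first by have /andP[] := pq j.
exact: le_lt_trans (ler_enorm _ _ pq) q1.
Qed.

Definition has_partials f G := forall k r, radii r ->
  dquot_within radii f r (delta_mx 0 k) --> G k r.

Lemma coordinate_increment f G k p (c g e : R) : has_partials f G -> 0 <= c ->
  (forall j, 0 <= p 0 j) -> radii (p + c *: delta_mx 0 k) ->
  (forall x, 0 <= x <= c -> `|G k (p + x *: delta_mx 0 k) - g| <= e) ->
  `|f (p + c *: delta_mx 0 k) - f p - c * g| <= e * c.
Proof.
move=> fG c0 p0 pc Gg.
have inr x : 0 <= x <= c -> radii (p + x *: delta_mx 0 k).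
  move=> /andP[x0 xc]; apply: radii_le pc => j; rewrite !mxE eqxx/=.
  by have := p0 j; case: (j == k) => /=; lra.
have := @mean_value_le _ c (fun x => f (p + x *: delta_mx 0 k))
  (fun x => G k (p + x *: delta_mx 0 k)) g e c0 _ Gg.
rewrite scale0r addr0; apply => x xc e' e'0.
have [d d0 Hd] := (dquot_withinP _ _ _ _ _).1 (fG k _ (inr _ xc)) e' e'0.
exists d => // h hd xh; have := Hd h hd.
by rewrite -addrA -scalerDl => /(_ (inr _ xh)).
Qed.

(** The path from p to q that changes one coordinate at a time.  It stays in the box
    spanned by p and q, hence in [radii] when q does. *)
Definition hybrid p q (m : nat) : 'rV[R]_n :=
  \row_j (if (j < m)%N then q 0 j else p 0 j).

(** One mean value inequality per coordinate, along the path of hybrids. *)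
Lemma box_increment f G p q (g : 'I_n -> R) (e : R) : has_partials f G ->
  (forall j, 0 <= p 0 j <= q 0 j) -> radii q ->
  (forall x : 'rV[R]_n, (forall j, p 0 j <= x 0 j <= q 0 j) ->
     forall j, `|G j x - g j| <= e) ->
  `|f q - f p - \sum_(j < n) (q 0 j - p 0 j) * g j|
    <= e * \sum_(j < n) (q 0 j - p 0 j).
Proof.
move=> fG pq rq Gg.
suff H m : (m <= n)%N -> `|f (hybrid p q m) - f p -
    \sum_(j < n | (j < m)%N) (q 0 j - p 0 j) * g j|
    <= e * \sum_(j < n | (j < m)%N) (q 0 j - p 0 j).
  have full (a : 'I_n -> R) : \sum_(j < n | (j < n)%N) a j = \sum_(j < n) a j.
    by apply: eq_bigl => j; rewrite ltn_ord.
  have := H n (leqnn n); rewrite !full.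
  by rewrite (_ : hybrid p q n = q)//; apply/rowP => j; rewrite mxE ltn_ord.
elim: m => [_|m IH mn].
  rewrite !big_pred0 ?subr0 ?mulr0// (_ : hybrid p q 0 = p); last first.
    by apply/rowP => j; rewrite mxE.
  by rewrite subrr normr0.
pose k := Ordinal mn; pose c := q 0 k - p 0 k.
have hS : hybrid p q m.+1 = hybrid p q m + c *: delta_mx 0 k.
  apply/rowP => j; rewrite !mxE eqxx/= ltnS leq_eqVlt.
  have [->|jk] := eqVneq j k; first by rewrite eqxx ltnn/= mulr1 /c subrKC.
  have /negbTE -> : (j : nat) != m by apply: contra_neq jk => jm; apply: val_inj.
  by rewrite mulr0 addr0.
have bigS (a : 'I_n -> R) : \sum_(j < n | (j < m.+1)%N) a j =
    a k + \sum_(j < n | (j < m)%N) a j.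
  rewrite (bigD1 k)//=; congr (_ + _); apply: eq_bigl => j.
  rewrite ltnS leq_eqVlt; have [->|jk] := eqVneq j k; first by rewrite eqxx ltnn.
  have /negbTE -> : (j : nat) != m by apply: contra_neq jk => jm; apply: val_inj.
  by rewrite andbT.
have c0 : 0 <= c by rewrite subr_ge0; have /andP[] := pq k.
have inbox x : 0 <= x <= c -> forall j,
    p 0 j <= (hybrid p q m + x *: delta_mx 0 k) 0 j <= q 0 j.
  move=> /andP[x0 xc] j; rewrite !mxE eqxx/=; have /andP[_ pqj] := pq j.
  have [->|jk] := eqVneq j k.
    by rewrite ltnn mulr1; move: xc; rewrite /c; lra.
  by rewrite mulr0 addr0; case: ifP; rewrite lexx ?andbT.
have hge0 j : 0 <= hybrid p q m 0 j.
  by rewrite mxE; have /andP[? ?] := pq j; case: ifP => _; lra.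
have hr : radii (hybrid p q m + c *: delta_mx 0 k).
  apply: radii_le rq => j; have /andP[p0 _] := pq j.
  by have /andP[pj ->] := inbox c ltac:(rewrite c0 lexx//) j; rewrite (le_trans p0 pj).
have := coordinate_increment _ _ _ _ _ (g k) e fG c0 hge0 hr.
move=> /(_ (fun x xc => Gg _ (inbox x xc) k)).
rewrite hS !bigS -/c [e * (c + _)]mulrDr; have := IH (ltnW mn).
set S1 := \sum_(j < n | (j < m)%N) _; set S2 := \sum_(j < n | (j < m)%N) _.
set f1 := f (hybrid p q m); set f2 := f (_ + _) => H1 H2.
have -> : f2 - f p - (c * g k + S1) = (f2 - f1 - c * g k) + (f1 - f p - S1) by ring.
by rewrite (le_trans (ler_normD _ _))// lerD.
Qed.

(** Since w >= 0, the points p and p + h w are comparable coordinatewise for either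
    sign of h, so [box_increment] applies to the box between them; on it the partial
    derivatives are close to their values at p. *)
Lemma ray_derivative f G p w : has_partials f G ->
  (forall k, {within radii, continuous (G k)}) ->
  radii p -> (forall j, 0 <= w 0 j) ->
  dquot_within radii f p w --> \sum_(k < n) w 0 k * G k p.
Proof.
move=> fG cG rp w0; apply/dquot_withinP => e e0.
pose W := \sum_(k < n) w 0 k; have W0 : 0 <= W by apply: sumr_ge0.
have W1 : 0 < W + 1 by rewrite ltr_wpDl.
have e1_gt0 : 0 < e / (W + 1) by rewrite divr_gt0.
set e1 := e / (W + 1) in e1_gt0.
have [d d0 Hd] : exists2 d, 0 < d & forall x, radii x ->
    (forall j, `|x 0 j - p 0 j| < d) -> forall k, `|G k x - G k p| <= e1.
  have dk k : exists d, 0 < d /\ forall x, radii x ->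
      (forall j, `|x 0 j - p 0 j| < d) -> `|G k x - G k p| <= e1.
    have /cvgrPdist_le/(_ e1 e1_gt0) := (subspace_continuousP _ _).1 (cG k) p rp.
    rewrite near_withinE => /nbhs_ballP[d /= d0 Hd]; exists d; split => // x rx xp.
    rewrite distrC; apply: Hd => //; split=> // i j; rewrite ord1 /ball/= distrC.
    exact: xp.
  have [dd Hdd] := choice dk.
  exists (\big[Num.min/1]_(k < n) dd k).
    by apply: lt_bigmin => // k _; have [] := Hdd k.
  move=> x rx xp k; have [_ Hk] := Hdd k; apply: Hk => // j.
  by apply: lt_le_trans (xp j) _; exact: bigmin_le_cond.
exists (d / (W + 1)); first by rewrite divr_gt0.
move=> h; rewrite ltr_pdivlMr// => hd rh.
have wW j : w 0 j <= W by rewrite /W (bigD1 j)//= lerDl sumr_ge0.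
have close (x : 'rV[R]_n) : (forall j, `|x 0 j - p 0 j| <= `|h| * w 0 j) -> radii x ->
    forall k, `|G k x - G k p| <= e1.
  move=> xp rx; apply: Hd => // j; apply: le_lt_trans (xp j) _.
  apply: le_lt_trans hd; rewrite ler_wpM2l//; have := wW j; lra.
have fin x : x <= e1 * (`|h| * W) -> x <= e * `|h|.
  move=> /le_trans; apply; rewrite /e1 mulrCA mulrC ler_wpM2r//.
  by rewrite mulrAC ler_pdivrMr// ler_pM2l// lerDl.
have [h0|h0] := leP 0 h.
- have box j : 0 <= p 0 j <= (p + h *: w) 0 j.
    by rewrite rp.1 !mxE lerDl mulr_ge0.
  have := box_increment f G p (p + h *: w) (fun k => G k p) e1 fG box rh.
  have -> : \sum_(j < n) ((p + h *: w) 0 j - p 0 j) * G j p =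
      h * \sum_(k < n) w 0 k * G k p.
    by rewrite mulr_sumr; apply: eq_bigr => j _; rewrite !mxE addrAC subrr add0r mulrA.
  have -> : \sum_(j < n) ((p + h *: w) 0 j - p 0 j) = `|h| * W.
    rewrite ger0_norm// mulr_sumr; apply: eq_bigr => j _.
    by rewrite !mxE addrAC subrr add0r.
  move=> H; apply/fin/H => x xbox; apply: close => [j|]; last first.
    apply: radii_le rh => j; have /andP[px ->] := xbox j.
    by rewrite (le_trans (rp.1 j) px).
  have := xbox j; rewrite !mxE => /andP[px xq].
  by rewrite ger0_norm ?subr_ge0// ger0_norm// lerBlDl.
- have box j : 0 <= (p + h *: w) 0 j <= p 0 j.
    by rewrite rh.1 !mxE gerDl mulr_le0_ge0// ltW.
  have := box_increment f G (p + h *: w) p (fun k => G k p) e1 fG box rp.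
  have -> : \sum_(j < n) (p 0 j - (p + h *: w) 0 j) * G j p =
      - (h * \sum_(k < n) w 0 k * G k p).
    rewrite mulr_sumr -sumrN; apply: eq_bigr => j _; rewrite !mxE; ring.
  have -> : \sum_(j < n) (p 0 j - (p + h *: w) 0 j) = `|h| * W.
    rewrite ltr0_norm// mulr_sumr; apply: eq_bigr => j _; rewrite !mxE; ring.
  set D := h * _; have -> : `|f p - f (p + h *: w) - - D| = `|f (p + h *: w) - f p - D|.
    by rewrite -normrN; congr (`|_|); ring.
  move=> H; apply/fin/H => x xbox; apply: close => [j|]; last first.
    apply: radii_le rp => j; have /andP[px ->] := xbox j.
    by rewrite (le_trans (rh.1 j) px).
  have := xbox j; rewrite !mxE => /andP[px xq].
  by rewrite ler0_norm ?subr_le0// ltr0_norm//; lra.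
Qed.

End Radii.

(** * Restriction to rays *)

Section Rays.
Context {R : realType} {n : nat}.
Implicit Types (r th : 'rV[R]_n) (t : R).

Lemma rstar_ge r j : r 0 j <= rstar r.
Proof. exact: le_bigmax_cond. Qed.

Lemma rstar_gt0 r : (forall j, 0 <= r 0 j) -> r != 0 -> 0 < rstar r.
Proof.
move=> r0 rn0; rewrite lt_neqAle; apply/andP; split; last exact: bigmax_ge_id.
apply: contra_neq rn0 => r00; apply/rowP => j; rewrite mxE.
by apply/eqP; rewrite eq_le r0 andbT r00 rstar_ge.
Qed.

Lemma radii_ray r t : radii r -> r != 0 -> 0 <= t <= rstar r ->
  radii ((t / rstar r) *: r).
Proof.
move=> rr rn0 /andP[t0 tr]; have r0 := rstar_gt0 _ rr.1 rn0.
apply: (radii_le _ _ _ rr) => j; have rj := rr.1 j; rewrite mxE mulr_ge0 ?divr_ge0// ?(ltW r0)//=.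
by rewrite ler_piMl// ler_pdivrMr// mul1r.
Qed.

Variables (f : 'rV[R]_n -> R) (G : 'I_n -> 'rV[R]_n -> R).
Hypotheses (fG : has_partials f G) (cG : forall k, {within radii, continuous (G k)}).

Definition ray_fun r t := f ((t / rstar r) *: r).
(** The derivative of [ray_fun] given by the chain rule. *)
Definition ray_slope r t := \sum_(k < n) r 0 k / rstar r * G k ((t / rstar r) *: r).

Lemma ray_dquot r t : radii r -> r != 0 -> 0 <= t <= rstar r ->
  dquot_within [set t : R | 0 <= t /\ t / rstar r * enorm r < 1] (ray_fun r) t 1 -->
    ray_slope r t.
Proof.
move=> rr rn0 tr; have r0 := rstar_gt0 _ rr.1 rn0.
apply/dquot_withinP => e e0.
have w0 j : 0 <= ((rstar r)^-1 *: r) 0 j.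
  by rewrite mxE mulr_ge0 ?invr_ge0 ?(ltW r0)//; exact: rr.1.
have := ray_derivative _ _ _ _ fG cG (radii_ray _ _ rr rn0 tr) w0.
move=> /dquot_withinP/(_ e e0)[d d0 Hd]; exists d => // h hd.
have -> : t + h *: (1 : R) = t + h by rewrite /GRing.scale/= mulr1.
move=> /= [th0 th1]; have := Hd h hd; rewrite scalerA -scalerDl -mulrDl /ray_fun.
have -> : \sum_(k < n) ((rstar r)^-1 *: r) 0 k * G k ((t / rstar r) *: r) = ray_slope r t.
  by apply: eq_bigr => k _; rewrite mxE [_^-1 * _]mulrC.
apply; split=> [j|]; last by rewrite enormZ// divr_ge0// ltW.
by rewrite mxE mulr_ge0 ?divr_ge0 ?(ltW r0)//; exact: rr.1.
Qed.

(** The limit is taken along the admissible t, which accumulate at t from the right,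
    even for t = rstar, because |R| < 1. *)
Lemma derive_ray r t : radii r -> r != 0 -> 0 <= t <= rstar r ->
  derive_within [set t : R | 0 <= t /\ t / rstar r * enorm r < 1] (ray_fun r) t 1 =
    ray_slope r t.
Proof.
move=> rr rn0 tr; apply: derive_within_eq (ray_dquot _ _ rr rn0 tr) => d d0.
have r0 := rstar_gt0 _ rr.1 rn0; have /andP[t0 t1] := tr.
pose s := (1 - enorm r) * rstar r.
have s0 : 0 < s by rewrite mulr_gt0// subr_gt0 rr.2.
have [md ms] : Num.min d s <= d /\ Num.min d s <= s by rewrite !ge_min !lexx orbT.
have m0 : 0 < Num.min d s by rewrite lt_min d0.
exists (Num.min d s / 2); first by apply/andP; split; lra.
set h := _ / 2; have h0 : 0 < h by rewrite /h divr_gt0.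
have hs : h < s by rewrite /h; lra.
have -> : t + h *: (1 : R) = t + h by rewrite /GRing.scale/= mulr1.
split; first by rewrite addr_ge0// ltW.
rewrite mulrAC ltr_pdivrMr// mul1r mulrDl.
have H1 : t * enorm r <= rstar r * enorm r by rewrite ler_wpM2r ?enorm_ge0.
have H2 : h * enorm r <= h by rewrite ler_piMr ?(ltW h0)// ltW//; exact: rr.2.
by rewrite /s in hs; lra.
Qed.

Lemma ray_first_order r : radii r -> r != 0 ->
  first_order (rstar r) (ray_fun r) (ray_slope r).
Proof.
move=> rr rn0 t tr e e0; have r0 := rstar_gt0 _ rr.1 rn0.
have /dquot_withinP/(_ e e0)[d d0 Hd] := ray_dquot _ _ rr rn0 tr.
exists d => // h hd thr; have := Hd h hd.
have -> : t + h *: (1 : R) = t + h by rewrite /GRing.scale/= mulr1.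
apply; split; first by case/andP: thr.
have [_] := radii_ray _ _ rr rn0 thr; rewrite enormZ// divr_ge0 ?(ltW r0)//.
by case/andP: thr.
Qed.

Lemma ray_slope_continuous r : radii r -> r != 0 ->
  {within `[0, rstar r], continuous (ray_slope r)}.
Proof.
move=> rr rn0; have r0 := rstar_gt0 _ rr.1 rn0.
apply/subspace_continuousP => t; rewrite /= in_itv/= => tr.
apply: cvg_big => [|k _]; first exact: add_continuous.
apply: cvgM; first exact: cvg_cst.
have rt := radii_ray _ _ rr rn0 tr.
apply/cvgrPdist_lt => e e0.
have /cvgrPdist_lt/(_ e e0) := (subspace_continuousP _ _).1 (cG k) _ rt.
rewrite !near_withinE => /nbhs_ballP[d /= d0 Hd].
apply/nbhs_ballP; exists d => // s; rewrite /ball/= => ts.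
rewrite in_itv/= => sr; apply: Hd (radii_ray _ _ rr rn0 sr) => /=.
split=> // i j; rewrite ord1 /ball/= !mxE -mulrBl -mulrBl normrM.
apply: le_lt_trans ts; rewrite normrM -mulrA ler_piMr//.
rewrite -normrM ger0_norm; last by rewrite mulr_ge0 ?invr_ge0 ?(ltW r0)//; exact: rr.1.
by rewrite mulrC ler_pdivrMr// mul1r rstar_ge.
Qed.

End Rays.

(** * One-sided estimates *)

Section DiniTools.
Context {R : realType}.

Lemma near_seq {T : Type} {I : eqType} (G : set_system T) {FG : Filter G}
    (l : seq I) (P : I -> T -> Prop) :
  (forall i, i \in l -> \forall x \near G, P i x) ->
  \forall x \near G, forall i, i \in l -> P i x.
Proof.
elim: l => [_|i l IH H]; first exact: nearW.
have Hi := H i (mem_head _ _).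
have {}IH := IH (fun j jl => H j (mem_behead (s := i :: l) jl)).
apply: filterS2 Hi IH => x Pi Pl j; rewrite inE => /predU1P[->//|]; exact: Pl.
Qed.

Lemma near_right_lt (t b : R) : t < b -> \forall s \near t^'+, t < s < b.
Proof.
by move=> tb; apply/at_rightP; exists (b - t); rewrite ?subr_gt0// => x; rewrite subrKC.
Qed.

(** To first order u t / u s is 1 - (s - t) u' / u, and only a negative u' makes it
    exceed 1.  The second-order terms are absorbed by e, and 1 + x <= exp x. *)
Lemma reciprocal_dini (b : R) (u du : R -> R) (t e : R) : first_order b u du ->
  (forall x, 0 <= x <= b -> 0 < u x) -> 0 <= t < b -> 0 < e ->
  \forall s \near t^'+, u t / u s <= expR ((s - t) * (pospart (- du t) / u t + e)).
Proof.
move=> Hu u_gt0 /andP[t0 tb] e0.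
have tI : 0 <= t <= b by rewrite t0 ltW.
have ut := u_gt0 t tI; set d := pospart _ / u t.
have d_ge0 : 0 <= d by rewrite divr_ge0 ?(ltW ut)// /pospart le_max lexx orbT.
have dud : 0 <= du t + u t * d.
  rewrite /d mulrC divfK ?gt_eqF// -lerBlDl sub0r.
  by rewrite /pospart le_max lexx.
pose e3 := u t * e / 2; have e30 : 0 < e3 by rewrite !(divr_gt0, mulr_gt0).
pose K := `|du t - e3| * (d + e) + 1.
have K0 : 0 < K by rewrite ltr_wpDl// mulr_ge0// addr_ge0// ltW.
have [d1 d10 Hd] := Hu t tI e3 e30.
apply/at_rightP; exists (Num.min (Num.min d1 (b - t)) (e3 / K)).
  by rewrite !lt_min d10 subr_gt0 tb divr_gt0.
move=> s /andP[ts]; rewrite -ltrBlDl !lt_min ltr_pdivlMr// -!andbA => /and3P[sd sb sK].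
set h := s - t in sd sb sK *; have h0 : 0 < h by rewrite subr_gt0.
have sI : 0 <= s <= b by move: sb; rewrite /h; lra.
have us := u_gt0 s sI; rewrite ler_pdivrMr//.
have := Hd h; rewrite gtr0_norm// (_ : t + h = s); last by rewrite subrKC.
move=> /(_ sd sI) /ler_normlP[Hh _].
have Hs : u t + h * (du t - e3) <= u s by lra.
apply: (@le_trans _ _ ((1 + h * (d + e)) * u s)); last first.
  by rewrite ler_pM2r// expR_ge1Dx.
have x0 : 0 < 1 + h * (d + e) by rewrite ltr_wpDr// mulr_ge0 ?ltW// ltr_wpDl.
apply: le_trans (ler_wpM2l (ltW x0) Hs).
have HK : - (`|du t - e3| * (d + e)) <= (du t - e3) * (d + e).
  rewrite -mulNr ler_wpM2r//; last by rewrite lerNl -normrN ler_norm.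
  by rewrite addr_ge0// ltW.
have H1 : h * (`|du t - e3| * (d + e)) <= e3.
  by apply: le_trans (ltW sK); rewrite ler_pM2l// /K lerDl.
have H2 : 0 <= h * (du t - e3 + u t * (d + e) + h * ((du t - e3) * (d + e))).
  apply: mulr_ge0; first exact: ltW.
  have : - (h * (`|du t - e3| * (d + e))) <= h * ((du t - e3) * (d + e)).
    by rewrite -mulrN ler_pM2l.
  have : u t * e = 2 * e3 by rewrite /e3; field.
  lra.
by rewrite -subr_ge0; apply: le_trans H2 _; rewrite le_eqVlt; apply/orP; left; apply/eqP; ring.
Qed.

Lemma within_left (b t : R) (Y : R -> R) : {within `[0, b], continuous Y} ->
  0 < t <= b -> Y s @[s --> t^'-] --> Y t.
Proof.
move=> cY /andP[t0 tb]; have b0 := lt_le_trans t0 tb.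
have [cin _ cb] := (continuous_within_itvP _ b0).1 cY.
move: tb; rewrite le_eqVlt => /predU1P[->//|tb].
by apply: cvg_at_left_filter; apply: cin; rewrite in_itv/= t0.
Qed.

End DiniTools.

(** * Polar coordinates *)

Section Polar.
Context {R : realType} {n : nat}.
Implicit Types (p q r th : 'rV[R]_n) (L : 'I_n -> 'rV[R[i]]_n -> R).

Lemma normc_polar p th j : normc (polar p th 0 j) = `|p 0 j|.
Proof. by rewrite mxE /= !exprMn -mulrDr cos2Dsin2 mulr1 sqrtr_sqr. Qed.

Lemma cnorm_polar p th : cnorm (polar p th) = enorm p.
Proof.
rewrite /cnorm /enorm; congr Num.sqrt; apply: eq_bigr => j _.
by rewrite normc_polar -normrX ger0_norm// sqr_ge0.
Qed.

Lemma cball_polar p th : radii p -> cball (polar p th).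
Proof. by case=> _ p1; rewrite /cball/= cnorm_polar. Qed.

Lemma polarD_scale p q th (h : R) :
  polar (p + h *: q) th = polar p th + h%:C *: polar q th.
Proof.
apply/rowP => j; rewrite !mxE.
by apply/eqP; rewrite eq_complex/=; apply/andP; split; apply/eqP; ring.
Qed.

Lemma polar0 th : polar 0 th = 0 :> 'rV[R[i]]_n.
Proof. by apply/rowP => j; rewrite !mxE !mul0r. Qed.

Lemma ufun_partials L j th : radially_C1 (L j) -> angles th ->
  exists G, has_partials (fun q => L j (polar q th)) G /\
    forall k, {within radii, continuous (G k)}.
Proof.
move=> LC1 thA; have [G HG] := choice (LC1 th thA).
by exists G; split=> [k|k]; have [] := HG k.
Qed.

Lemma ufun_first_order L j th r : radially_C1 (L j) -> angles th ->
  radii r -> r != 0 ->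
  first_order (rstar r) (ufun L j r th) (dufun L j r th) /\
  {within `[0, rstar r], continuous (dufun L j r th)}.
Proof.
move=> LC1 thA rr rn0; have [G [fG cG]] := ufun_partials _ _ _ LC1 thA.
have E t : 0 <= t <= rstar r -> dufun L j r th t = ray_slope G r t.
  by move=> tr; rewrite -(derive_ray _ _ fG cG r t rr rn0 tr).
split.
  move=> x xr e e0; rewrite E//.
  exact: (ray_first_order _ _ fG cG r rr rn0 x xr e e0).
apply: subspace_eq_continuous (ray_slope_continuous _ cG r rr rn0) => t.
by rewrite inE/= in_itv/= => tr; rewrite /from_subspace E.
Qed.

Lemma ufun_continuous L j th r : radially_C1 (L j) -> angles th ->
  radii r -> r != 0 -> {within `[0, rstar r], continuous (ufun L j r th)}.
Proof.
move=> LC1 thA rr rn0; have [H _] := ufun_first_order _ _ _ _ LC1 thA rr rn0.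
exact: first_order_continuous H.
Qed.

End Polar.

(** * Continuous functions on a segment *)

Section ContinuityOnSegment.
Context {R : realType}.
Variable b : R.
Implicit Types Y Z : R -> R.

Lemma cont_onP Y : {within `[0, b], continuous Y} <->
  forall t, 0 <= t <= b -> Y s @[s --> within `[0, b] (nbhs t)] --> Y t.
Proof.
split=> [/subspace_continuousP H t tb|H].
  by apply: (H t); rewrite /= in_itv.
by apply/subspace_continuousP => t; rewrite /= in_itv/= => tb; exact: H.
Qed.

Lemma cont_onD Y Z : {within `[0, b], continuous Y} ->
  {within `[0, b], continuous Z} -> {within `[0, b], continuous (fun t => Y t + Z t)}.
Proof. by move=> /cont_onP cY /cont_onP cZ; apply/cont_onP => t tb; apply: cvgD; auto. Qed.

Lemma cont_onM Y Z : {within `[0, b], continuous Y} ->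
  {within `[0, b], continuous Z} -> {within `[0, b], continuous (fun t => Y t * Z t)}.
Proof. by move=> /cont_onP cY /cont_onP cZ; apply/cont_onP => t tb; apply: cvgM; auto. Qed.

Lemma cont_onX Y k : {within `[0, b], continuous Y} ->
  {within `[0, b], continuous (fun t => Y t ^+ k)}.
Proof.
move=> cY; elim: k => [|k IH].
  by apply/cont_onP => t tb; under eq_cvg do rewrite expr0; exact: cvg_cst.
apply: subspace_eq_continuous (cont_onM _ _ cY IH) => t _.
by rewrite /from_subspace exprS.
Qed.

Lemma cont_onN Y : {within `[0, b], continuous Y} ->
  {within `[0, b], continuous (fun t => - Y t)}.
Proof. by move=> /cont_onP cY; apply/cont_onP => t tb; apply: cvgN; auto. Qed.

Lemma cont_onV Y : (forall t, 0 <= t <= b -> Y t != 0) ->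
  {within `[0, b], continuous Y} -> {within `[0, b], continuous (fun t => (Y t)^-1)}.
Proof.
by move=> Y0 /cont_onP cY; apply/cont_onP => t tb; apply: cvgV; [exact: Y0|exact: cY].
Qed.

Lemma cont_on_cst (a : R) : {within `[0, b], continuous (fun _ : R => a)}.
Proof. by apply/cont_onP => t tb; exact: cvg_cst. Qed.

Lemma cont_on_big {I : Type} (op : R -> R -> R) (x0 : R) (l : seq I) (P : pred I)
    (Y : I -> R -> R) : continuous (fun x : R * R => op x.1 x.2) ->
  (forall i, P i -> {within `[0, b], continuous (Y i)}) ->
  {within `[0, b], continuous (fun t => \big[op/x0]_(i <- l | P i) Y i t)}.
Proof.
move=> cop cY; apply/cont_onP => t tb; apply: cvg_big => // i Pi.
by move/cont_onP : (cY i Pi); apply.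
Qed.

Lemma cont_on_pospart Y : {within `[0, b], continuous Y} ->
  {within `[0, b], continuous (fun t => pospart (Y t))}.
Proof.
(* the positive part is a maximum over a one-element family, with default 0 *)
move=> cY; have := @cont_on_big _ Num.max 0 [:: tt] xpredT (fun=> Y)
  max_continuous (fun _ _ => cY).
apply: subspace_eq_continuous => t _.
by rewrite /from_subspace big_cons big_nil.
Qed.

Lemma cont_on_mmax {n : nat} m (Y : mindex n -> R -> R) :
  (forall S, {within `[0, b], continuous (Y S)}) ->
  {within `[0, b], continuous (fun t => mmax m (Y^~ t))}.
Proof. by move=> cY; apply: cont_on_big => [|S _]; [exact: max_continuous|exact: cY]. Qed.

Lemma cont_on_sum {n : nat} (Y : 'I_n -> R -> R) :
  (forall j, {within `[0, b], continuous (Y j)}) ->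
  {within `[0, b], continuous (fun t => \sum_(j < n) Y j t)}.
Proof. by move=> cY; apply: cont_on_big => [|j _]; [exact: add_continuous|exact: cY]. Qed.

Lemma cont_on_prod {n : nat} (Y : 'I_n -> R -> R) :
  (forall j, {within `[0, b], continuous (Y j)}) ->
  {within `[0, b], continuous (fun t => \prod_(j < n) Y j t)}.
Proof. by move=> cY; apply: cont_on_big => [|j _]; [exact: mul_continuous|exact: cY]. Qed.

End ContinuityOnSegment.

(** * Growth of the index maximum along a ray *)

Section IndexGrowth.
Context {R : realType} {n : nat}.
Variables (L : 'I_n -> 'rV[R[i]]_n -> R) (F : 'rV[R[i]]_n -> R[i]) (N : nat).
Hypothesis L_pos : forall j z, cball z -> 0 < L j z.
Hypothesis L_C1 : forall j, radially_C1 (L j).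
Hypothesis F_an : analytic_on_ball F.
Hypothesis F_index : Lindex_bound F L N.
Variables (r th : 'rV[R]_n).
Hypotheses (thA : angles th) (rr : radii r) (rn0 : r != 0).
Implicit Types (S : mindex n) (t : R).

Let b := rstar r.
Let u j t := ufun L j r th t.
Let du j t := dufun L j r th t.

Definition ray t := polar ((t / rstar r) *: r) th.
Definition ray_index t := mmax N (fun S => Lcoef F L S (ray t)).
Definition weight S t : R := (mfact S)%:R * mpow (fun j => ufun L j r th t) S.

(** The part of the rate due to the numerators, whose order of differentiation rises
    from S to S + e_j. *)
Definition order_rate t := mmax N (fun S : mindex n =>
  \sum_(j < n) r 0 j / rstar r * ((S j)%:R + 1) * ufun L j r th t).
(** The part of the rate due to the denominators, when L decreases. *)
Definition decay_rate t := mmax N (fun S : mindex n =>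
  \sum_(j < n) (S j)%:R * pospart (- dufun L j r th t) / ufun L j r th t).

Lemma rstar_pos : 0 < b. Proof. exact: rstar_gt0 rr.1 rn0. Qed.

Lemma ray_in_ball t : 0 <= t <= b -> cball (ray t).
Proof. by move=> tb; apply: cball_polar; exact: radii_ray. Qed.

Lemma ufun_gt0 j t : 0 <= t <= b -> 0 < u j t.
Proof. by move=> tb; apply: L_pos; exact: ray_in_ball. Qed.

Lemma mfact_gt0 S : (0 < mfact S)%N.
Proof. by apply: prodn_gt0 => j; exact: fact_gt0. Qed.

Lemma weight_gt0 S t : 0 <= t <= b -> 0 < weight S t.
Proof.
move=> tb; rewrite mulr_gt0 ?ltr0n ?mfact_gt0// prodr_gt0// => j _.
by rewrite exprn_gt0//; exact: ufun_gt0.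
Qed.

Lemma LcoefE S t : Lcoef F L S (ray t) = normc (mderiv S F (ray t)) / weight S t.
Proof. by []. Qed.

Lemma weight_incr k S t : weight (mincr k S) t = weight S t * ((S k)%:R + 1) * u k t.
Proof.
rewrite /weight.
have -> : mfact (mincr k S) = (mfact S * (S k).+1)%N.
  rewrite /mfact (bigD1 k)//= [in RHS](bigD1 k)//= ffunE eqxx addn1 factS.
  rewrite [RHS]mulnC mulnA; congr muln.
  by apply: eq_bigr => j /negbTE jk; rewrite ffunE jk addn0.
have -> : mpow (fun j => ufun L j r th t) (mincr k S) =
    mpow (fun j => ufun L j r th t) S * u k t.
  rewrite /mpow (bigD1 k)//= [in RHS](bigD1 k)//= ffunE eqxx addn1 exprS -/(u k t).
  rewrite [RHS]mulrC -[LHS]mulrA; congr (_ * (_ * _)).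
  by apply: eq_bigr => j /negbTE jk; rewrite ffunE jk addn0.
by rewrite natrM -natr1; ring.
Qed.

(** The derivative of F^(S) along the ray, multiplied by rstar. *)
Let dray S t := \sum_(k < n) polar r th 0 k * mderiv (mincr k S) F (ray t).

Lemma ray_expansion S t : 0 <= t <= b -> exists d M, 0 < d /\
  forall s, `|s - t| < d ->
    normc (mderiv S F (ray s) - mderiv S F (ray t) - ((s - t) / b)%:C * dray S t)
      <= M * `|s - t| ^+ 2.
Proof.
move=> tb; have b0 := rstar_pos.
have [h0 [M [h0_gt0 H]]] :=
  mderiv_differentiable F (ray t) (polar r th) S F_an (ray_in_ball _ tb).
exists (h0 * b), (M / b ^+ 2); split; first exact: mulr_gt0.
move=> s st; have E : normc ((s - t) / b)%:C = `|s - t| / b.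
  by rewrite normc_real normrM normfV (gtr0_norm b0).
have := H ((s - t) / b)%:C; rewrite E -polarD_scale -scalerDl.
rewrite (_ : t / rstar r + (s - t) / b = s / rstar r); last by rewrite -mulrDl subrKC.
move=> /(_ _)/le_trans; apply; first by rewrite ler_pdivrMr// ltW.
by rewrite expr_div_n mulrA mulrAC.
Qed.

Lemma ray_mderiv_continuous S :
  {within `[0, b], continuous (fun t => normc (mderiv S F (ray t)))}.
Proof.
apply/cont_onP => t tb; have b0 := rstar_pos.
have [d [M [d0 H]]] := ray_expansion S _ tb.
apply/cvgrPdist_lt => e e0; rewrite near_withinE; apply/nbhs_ballP.
pose K := normc (dray S t) / b + `|M| + 1.
have K0 : 0 < K by rewrite ltr_wpDl// addr_ge0// divr_ge0 ?normc_ge0// ltW.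
exists (Num.min (Num.min d 1) (e / K)); first by rewrite /= !lt_min d0 ltr01 divr_gt0.
move=> s; rewrite /ball/= !lt_min [`|t - s|]distrC ltr_pdivlMr// -andbA.
move=> /and3P[sd s1 se] _.
have Hs := H s sd.
apply: le_lt_trans se.
have Hn : normc (mderiv S F (ray s) - mderiv S F (ray t)) <= `|s - t| * K.
  rewrite -[X in normc X](subrK (((s - t) / b)%:C * dray S t)).
  rewrite (le_trans (normc_leD _ _))// Normc.normcM normc_real normrM normfV (gtr0_norm b0).
  have : M * `|s - t| ^+ 2 <= `|s - t| * `|M|.
    apply: (@le_trans _ _ (`|M| * `|s - t| ^+ 2)).
      by rewrite ler_wpM2r ?sqr_ge0// ler_norm.
    by rewrite mulrC ler_wpM2r// expr2 ler_piMl// ltW.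
  rewrite /K !mulrDr; have := normr_ge0 (s - t); lra.
apply: le_trans Hn; rewrite ler_norml; apply/andP; split.
  rewrite lerNl opprB lerBlDr.
  by have := normc_leD (mderiv S F (ray s) - mderiv S F (ray t)) (mderiv S F (ray t));
    rewrite subrK.
rewrite lerBlDr -(normc_opp (_ - _)) opprB.
by have := normc_leD (mderiv S F (ray t) - mderiv S F (ray s)) (mderiv S F (ray s));
  rewrite subrK.
Qed.

Lemma weight_continuous S : {within `[0, b], continuous (weight S)}.
Proof.
apply: cont_onM; first exact: cont_on_cst.
apply: cont_on_prod => j; apply: cont_onX; exact: ufun_continuous.
Qed.

Lemma ray_index_continuous : {within `[0, b], continuous ray_index}.
Proof.
apply: cont_on_mmax => S; apply: cont_onM; first exact: ray_mderiv_continuous.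
apply: cont_onV (weight_continuous S) => t tb; by rewrite gt_eqF// weight_gt0.
Qed.

(** The index bound is applied to S + e_k, which may have order N + 1; this is the
    only place where the index of F enters the growth estimate. *)
Lemma dray_le S t : (mnorm S <= N)%N -> 0 <= t <= b ->
  normc (dray S t) <= weight S t * ray_index t * (b * order_rate t).
Proof.
move=> SN tb; have b0 := rstar_pos; have W0 := weight_gt0 S _ tb.
have g0 : 0 <= ray_index t := mmax_ge0 _ _.
apply: (@le_trans _ _ (weight S t * ray_index t *
  (b * \sum_(j < n) r 0 j / rstar r * ((S j)%:R + 1) * ufun L j r th t))); last first.
  apply: ler_wpM2l; first by rewrite mulr_ge0// ltW.
  by rewrite ler_pM2l//; exact: mmax_ge.
rewrite (le_trans (normc_sum _ _ _ _))// !mulr_sumr; apply: ler_sum => k _.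
rewrite Normc.normcM normc_polar (ger0_norm (rr.1 k)).
have W1 := weight_gt0 (mincr k S) _ tb.
have := F_index (ray t) (ray_in_ball _ tb) (mincr k S).
rewrite LcoefE -/(ray_index t) ler_pdivrMr// weight_incr => H.
apply: le_trans (ler_wpM2l (rr.1 k) H) _.
rewrite le_eqVlt; apply/orP; left; apply/eqP; rewrite /u -/b; field.
by rewrite gt_eqF.
Qed.

(** The weight is frozen at t; its variation is the subject of [weight_dini]. *)
Lemma numerator_dini S t e : (mnorm S <= N)%N -> 0 <= t < b -> 0 < e ->
  \forall s \near t^'+, normc (mderiv S F (ray s)) / weight S t <=
    ray_index t + (s - t) * (order_rate t * ray_index t + e).
Proof.
move=> SN /andP[t0 tb] e0; have b0 := rstar_pos.
have tI : 0 <= t <= b by rewrite t0 ltW.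
have W0 := weight_gt0 S _ tI.
have [d [M [d0 H]]] := ray_expansion S _ tI.
have M1 : 0 < `|M| + 1 by rewrite ltr_wpDl.
apply/at_rightP; exists (Num.min d (e * weight S t / (`|M| + 1))).
  rewrite lt_min d0/=; apply: divr_gt0 => //; exact: mulr_gt0.
move=> s /andP[ts]; rewrite -ltrBlDl lt_min ltr_pdivlMr// => /andP[sd se].
have st0 : 0 < s - t by rewrite subr_gt0.
have := H s; rewrite gtr0_norm// => /(_ sd) Hs.
rewrite ler_pdivrMr//.
have Hg : normc (mderiv S F (ray t)) <= ray_index t * weight S t.
  by rewrite -ler_pdivrMr//; exact: (mmax_ge N (fun S => Lcoef F L S (ray t)) S SN).
have HD : normc (((s - t) / b)%:C * dray S t) <=
    (s - t) * (order_rate t * ray_index t * weight S t).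
  have sb0 : 0 <= (s - t) / b by apply: divr_ge0; exact: ltW.
  rewrite Normc.normcM normc_real (ger0_norm sb0).
  apply: le_trans (ler_wpM2l sb0 (dray_le _ _ SN tI)) _.
  by rewrite le_eqVlt; apply/orP; left; apply/eqP; field; rewrite gt_eqF.
have HM : M * (s - t) ^+ 2 <= (s - t) * (e * weight S t).
  apply: (@le_trans _ _ ((s - t) * ((s - t) * (`|M| + 1)))); last first.
    by rewrite ler_pM2l// ltW.
  rewrite expr2 mulrCA ler_pM2l// mulrC ler_pM2l//.
  by have := ler_norm M; lra.
have E : mderiv S F (ray s) = (mderiv S F (ray s) - mderiv S F (ray t)
    - ((s - t) / b)%:C * dray S t) + mderiv S F (ray t) + ((s - t) / b)%:C * dray S t.
  by ring.
rewrite E (le_trans (normc_leD _ _))//.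
have := normc_leD (mderiv S F (ray s) - mderiv S F (ray t) -
  ((s - t) / b)%:C * dray S t) (mderiv S F (ray t)).
by lra.
Qed.

Lemma weight_dini S t e : (mnorm S <= N)%N -> 0 <= t < b -> 0 < e ->
  \forall s \near t^'+, weight S t / weight S s <= expR ((s - t) * (decay_rate t + e)).
Proof.
move=> SN tI e0; have [t0 tb] := andP tI; have tI' : 0 <= t <= b by rewrite t0 ltW.
(* there are at most N factors, counted with multiplicity *)
pose e2 := e / (N%:R + 1); have N1 : 0 < N%:R + 1 :> R by rewrite ltr_wpDl.
have e20 : 0 < e2 by rewrite divr_gt0.
have H : \forall s \near t^'+, forall j, j \in enum 'I_n ->
    u j t / u j s <= expR ((s - t) * (pospart (- du j t) / u j t + e2)).
  apply: near_seq => j _.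
  have [fo _] := ufun_first_order _ _ _ _ (L_C1 j) thA rr rn0.
  by apply: reciprocal_dini fo _ tI e20 => x xb; exact: ufun_gt0.
apply: filterS2 H (near_right_lt _ _ tb) => s Hs /andP[ts sb].
have sI : 0 <= s <= b by lra.
have -> : weight S t / weight S s = \prod_(j < n) (u j t / u j s) ^+ S j.
  rewrite /weight invfM mulrACA divff ?pnatr_eq0 -?lt0n ?mfact_gt0// mul1r.
  rewrite /mpow -prodfV -big_split/=; apply: eq_bigr => j _.
  by rewrite expr_div_n.
apply: (@le_trans _ _ (\prod_(j < n)
    expR ((s - t) * (pospart (- du j t) / u j t + e2)) ^+ S j)).
  apply: ler_prod => j _; have uj : 0 <= u j t / u j s.
    by rewrite divr_ge0// ltW// ufun_gt0.
  rewrite exprn_ge0//=; apply: lerXn2r; rewrite ?nnegrE ?expR_ge0//.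
  by apply: Hs; rewrite mem_enum.
have -> : \prod_(j < n) expR ((s - t) * (pospart (- du j t) / u j t + e2)) ^+ S j =
    expR (\sum_(j < n) (S j)%:R * ((s - t) * (pospart (- du j t) / u j t + e2))).
  by rewrite expR_sum; apply: eq_bigr => j _; rewrite expRM_natl.
rewrite ler_expR.
have -> : \sum_(j < n) (S j)%:R * ((s - t) * (pospart (- du j t) / u j t + e2)) =
    (s - t) * (\sum_(j < n) (S j)%:R * pospart (- du j t) / u j t + (mnorm S)%:R * e2).
  rewrite /mnorm natr_sum mulrDr mulr_suml !mulr_sumr -big_split/=.
  by apply: eq_bigr => j _; ring.
rewrite ler_pM2l ?subr_gt0//; apply: lerD.
  exact: (mmax_ge N (fun S : mindex n => \sum_(j < n) (S j)%:R * pospart (- du j t) / u j t)).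
rewrite /e2 mulrA ler_pdivrMr// mulrC ler_pM2l//.
by apply: (@le_trans _ _ N%:R); rewrite ?ler_nat// lerDl.
Qed.

(** Each quotient at s is a frozen quotient times a ratio of weights, and 1 + x <= exp x
    turns both factors into exponentials.  There are finitely many S, so one
    neighbourhood of t serves for all of them. *)
Lemma ray_index_dini (eta t e : R) : 0 < eta -> 0 <= t < b -> 0 < e ->
  \forall s \near t^'+, ln (ray_index s + eta) <=
    ln (ray_index t + eta) + (s - t) * (order_rate t + decay_rate t + e).
Proof.
move=> eta0 tI e0; have [t0 tb] := andP tI.
pose e1 := e / 2; have e10 : 0 < e1 by rewrite divr_gt0.
have g0 x : 0 <= ray_index x := mmax_ge0 _ _.
have A0 : 0 <= order_rate t := mmax_ge0 _ _.
have B0 : 0 <= decay_rate t := mmax_ge0 _ _.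
have gt0 x : 0 < ray_index x + eta by rewrite ltr_wpDl.
have H : \forall s \near t^'+, forall S, S \in mindices N ->
    normc (mderiv S F (ray s)) / weight S t <=
      ray_index t + (s - t) * (order_rate t * ray_index t + eta * e1) /\
    weight S t / weight S s <= expR ((s - t) * (decay_rate t + e1)).
  apply: near_seq => S; rewrite mem_mindices => SN.
  apply: filterS2 (numerator_dini S t (eta * e1) SN tI (mulr_gt0 eta0 e10))
    (weight_dini S t e1 SN tI e10) => s; by split.
apply: filterS2 H (near_right_lt _ _ tb) => s Hs /andP[ts sb].
have h0 : 0 < s - t by rewrite subr_gt0.
have sI : 0 <= s <= b by lra.
have tI' : 0 <= t <= b by lra.
set h := s - t in h0 Hs *.
pose X := (ray_index t + eta) * expR (h * (order_rate t + decay_rate t + e)).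
suff HX : ray_index s + eta <= X.
  have -> : ln (ray_index t + eta) + h * (order_rate t + decay_rate t + e) = ln X.
    by rewrite lnM ?posrE ?expR_gt0// expRK.
  by rewrite ler_ln ?posrE// mulr_gt0// expR_gt0.
rewrite -lerBrDr; apply: mmax_le => [|S SN].
  rewrite subr_ge0; apply: (@le_trans _ _ (ray_index t + eta)).
    by rewrite lerDr.
  by rewrite /X ler_peMr ?(ltW (gt0 t))// -expR0 ler_expR mulr_ge0 ?(ltW h0)// !addr_ge0// ltW.
have [] := Hs S; first by rewrite mem_mindices.
set a := _ / weight S t; set q := weight S t / _ => Ha Hq.
have Wt := weight_gt0 S _ tI'; have Ws := weight_gt0 S _ sI.
have a0 : 0 <= a by rewrite divr_ge0 ?normc_ge0// ltW.
have -> : Lcoef F L S (ray s) = a * q.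
  by rewrite LcoefE /a /q mulrA divfK// gt_eqF.
pose E := expR (h * (decay_rate t + e1)).
have E1 : 1 <= E by rewrite -expR0 ler_expR mulr_ge0 ?(ltW h0)// addr_ge0// ltW.
rewrite lerBrDr; apply: (@le_trans _ _ ((a + eta) * E)).
  rewrite mulrDl; apply: lerD; first by rewrite ler_wpM2l.
  by rewrite ler_peMr// ltW.
have -> : X = (ray_index t + eta) * expR (h * (order_rate t + e1)) * E.
  by rewrite /X -mulrA -expRD -mulrDr /e1; congr (_ * expR (_ * _)); field.
rewrite ler_pM2r ?expR_gt0//.
apply: (@le_trans _ _ ((ray_index t + eta) * (1 + h * (order_rate t + e1)))); last first.
  by rewrite ler_pM2l// expR_ge1Dx.
have K1 : 0 <= h * (eta * order_rate t) by rewrite !mulr_ge0// ltW.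
have K2 : 0 <= h * (ray_index t * e1) by rewrite !mulr_ge0// ltW.
lra.
Qed.

Lemma rates_continuous :
  {within `[0, b], continuous (fun t => order_rate t + decay_rate t)}.
Proof.
apply: cont_onD; apply: cont_on_mmax => S; apply: cont_on_sum => j.
  apply: cont_onM; first exact: cont_on_cst.
  exact: ufun_continuous.
have [_ cdu] := ufun_first_order _ _ _ _ (L_C1 j) thA rr rn0.
apply: cont_onM; last first.
  apply: cont_onV => [t tb|]; last exact: ufun_continuous.
  by rewrite gt_eqF//; exact: ufun_gt0.
apply: cont_onM; first exact: cont_on_cst.
by apply: cont_on_pospart; exact: cont_onN.
Qed.

Lemma rates_ge0 t : 0 <= order_rate t + decay_rate t.
Proof. by rewrite addr_ge0// mmax_ge0. Qed.

(** [dini_le_integral] for ln (g + eta), with eta tending to 0.  For g 0 = 0 this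
    yields g = 0 on the whole ray. *)
Lemma ray_index_growth : ray_index b <= ray_index 0 *
  expR (\int[lebesgue_measure]_(t in `[0, b]) (order_rate t + decay_rate t)).
Proof.
have b0 := rstar_pos; set I := Rintegral _ _ _.
have g0 x : 0 <= ray_index x := mmax_ge0 _ _.
have key eta : 0 < eta -> ray_index b + eta <= (ray_index 0 + eta) * expR I.
  move=> eta0; have gt0 x : 0 < ray_index x + eta by rewrite ltr_wpDl.
  have := @dini_le_integral _ b (fun t => ln (ray_index t + eta))
    (fun t => order_rate t + decay_rate t) (ltW b0) rates_continuous
    (fun t _ => rates_ge0 t).
  rewrite -/I => /(_ _ (fun t e tb e0 => ray_index_dini _ _ _ eta0 tb e0)).
  have -> : ln (ray_index 0 + eta) + I = ln ((ray_index 0 + eta) * expR I).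
    by rewrite lnM ?posrE ?expR_gt0// expRK.
  rewrite ler_ln ?posrE ?mulr_gt0 ?expR_gt0//; apply => t tb.
  have cont : {within `[0, b], continuous (fun t => ray_index t + eta)}.
    by apply: cont_onD; [exact: ray_index_continuous|exact: cont_on_cst].
  have := within_left _ _ _ cont tb.
  move=> /continuous_cvg; apply; exact: continuous_ln.
apply/ler_addgt0Pr => e e0.
have eta0 : 0 < e / expR I by rewrite divr_gt0// expR_gt0.
have := key _ eta0; rewrite mulrDl divfK ?gt_eqF ?expR_gt0//; lra.
Qed.

End IndexGrowth.

(** * Integrals along rays and growth on tori *)

Section RayIntegral.
Context {R : realType} {n : nat}.
Variables (L : 'I_n -> 'rV[R[i]]_n -> R).
Hypothesis L_pos : forall j z, cball z -> 0 < L j z.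
Hypothesis L_C1 : forall j, radially_C1 (L j).
Implicit Types (r th : 'rV[R]_n).

Definition ray_density r th (t : R) := \sum_(j < n) r 0 j / rstar r * ufun L j r th t.
Definition ray_integral r th : R :=
  \int[lebesgue_measure]_(t in `[0, rstar r]) ray_density r th t.

Lemma continuous_integral_EFin (b : R) (phi : R -> R) :
  {within `[0, b], continuous phi} ->
  (\int[lebesgue_measure]_(t in `[0%R, b]) (phi t)%:E)%E =
  (\int[lebesgue_measure]_(t in `[0, b]) phi t)%:E.
Proof.
move=> cphi; rewrite /Rintegral fineK//; apply: integrable_fin_num => //.
by apply: continuous_compact_integrable => //; exact: segment_compact.
Qed.

Lemma ray_density_continuous r th : angles th -> radii r -> r != 0 ->
  {within `[0, rstar r], continuous (ray_density r th)}.
Proof.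
move=> thA rr rn0; apply: cont_on_sum => j.
by apply: cont_onM; [exact: cont_on_cst | exact: ufun_continuous].
Qed.

Lemma ray_density_ge0 r th t : radii r -> r != 0 -> 0 <= t <= rstar r ->
  0 <= ray_density r th t.
Proof.
move=> rr rn0 tr; apply: sumr_ge0 => j _; have r0 := rstar_gt0 _ rr.1 rn0.
apply: mulr_ge0; first by rewrite divr_ge0 ?(ltW r0)//; exact: rr.1.
by apply/ltW; exact: ufun_gt0.
Qed.

Lemma enorm_le_sum r : (forall j, 0 <= r 0 j) -> enorm r <= \sum_(j < n) r 0 j.
Proof.
move=> r0; have s0 : 0 <= \sum_(j < n) r 0 j by apply: sumr_ge0.
rewrite -(ger0_norm s0) -sqrtr_sqr; apply: ler_wsqrtr.
rewrite expr2 mulr_suml; apply: ler_sum => j _; rewrite expr2 ler_wpM2l//.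
by rewrite (bigD1 j)//= lerDl sumr_ge0.
Qed.

Variable beta : R.
Hypothesis beta_gt0 : 0 < beta.
Hypothesis L_beta : forall j z, cball z -> beta / (1 - cnorm z) < L j z.

(** The function - beta ln (1 - t |R| / rstar) grows at a rate of at most the density,
    by the lower bound on L and because the sum of the r_j is at least |R|. *)
Lemma ray_integral_ge r th : angles th -> radii r -> r != 0 ->
  - beta * ln (1 - enorm r) <= ray_integral r th.
Proof.
move=> thA rr rn0; have b0 := rstar_gt0 _ rr.1 rn0; set b := rstar r in b0 *.
pose rho := enorm r / b.
have rho0 : 0 <= rho by rewrite divr_ge0 ?enorm_ge0// ltW.
have pos t : 0 <= t <= b -> 0 < 1 - t * rho.
  move=> /andP[t0 tb]; rewrite subr_gt0 /rho mulrA ltr_pdivrMr// mul1r.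
  have : t * enorm r <= b * enorm r by rewrite ler_wpM2r// enorm_ge0.
  by move=> /le_lt_trans; apply; rewrite -[ltRHS]mulr1 ltr_pM2l//; exact: rr.2.
have density_ge s : 0 <= s <= b -> beta * rho / (1 - s * rho) <= ray_density r th s.
  move=> sb; have [s0 _] := andP sb.
  apply: (@le_trans _ _ (\sum_(j < n) r 0 j / b * (beta / (1 - s * rho)))).
    rewrite -mulr_suml -mulr_suml mulrAC [leLHS]mulrC.
    apply: ler_wpM2r; last by rewrite ler_pM2r ?invr_gt0//; exact: enorm_le_sum rr.1.
    by apply: divr_ge0; apply: ltW => //; exact: pos.
  apply: ler_sum => j _; apply: ler_wpM2l.
    by rewrite divr_ge0 ?(ltW b0)//; exact: rr.1.
  have := L_beta j _ (ray_in_ball r th rr rn0 s sb).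
  rewrite cnorm_polar enormZ ?divr_ge0 ?(ltW b0)// => /ltW.
  by rewrite /rho mulrAC mulrA.
have := @dini_le_integral _ b (fun t => - beta * ln (1 - t * rho))
  (ray_density r th) (ltW b0) (ray_density_continuous _ _ thA rr rn0)
  (fun t => ray_density_ge0 _ th t rr rn0).
rewrite mul0r subr0 ln1 mulr0 add0r /rho [b * _]mulrC divfK ?gt_eqF// -/rho; apply.
- move=> t /andP[t0 tb]; apply: cvgM; first exact: cvg_cst.
  have tI : 0 <= t <= b by rewrite ltW.
  apply: continuous_cvg; first by apply: continuous_ln; exact: pos.
  apply: cvgB; first exact: cvg_cst.
  by apply: cvgM; [apply: cvg_at_left_filter; exact: cvg_id | exact: cvg_cst].
- move=> t e tI e0; have [t0 tb] := andP tI.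
  have := within_right _ _ _ (ray_density_continuous _ _ thA rr rn0) tI.
  move=> /cvgrPdist_lt/(_ e e0) Hd.
  apply: filterS2 Hd (near_right_lt _ _ tb) => s Hs /andP[ts sb].
  have sI : 0 <= s <= b by lra.
  have tI' : 0 <= t <= b by lra.
  have Ps := pos s sI; have Pt := pos t tI'.
  have h0 : 0 < s - t by lra.
  have D1 : ray_density r th s <= ray_density r th t + e.
    by move: Hs; rewrite ltr_norml => /andP[H _]; lra.
  (* ln x <= x - 1 compares the increment with the density at s, which is close to
     the density at t *)
  apply: (@le_trans _ _ (- beta * ln (1 - t * rho) + (s - t) * ray_density r th s)).
    2: by rewrite lerD2l ler_pM2l.
  apply: (@le_trans _ _ (- beta * ln (1 - t * rho) +
    (s - t) * (beta * rho / (1 - s * rho)))).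
    2: by rewrite lerD2l ler_pM2l// density_ge.
  have H : ln ((1 - t * rho) / (1 - s * rho)) <= (s - t) * rho / (1 - s * rho).
    have -> : (1 - t * rho) / (1 - s * rho) = 1 + (s - t) * rho / (1 - s * rho).
      by field; rewrite gt_eqF.
    apply: le_ln1Dx; rewrite (@lt_le_trans _ _ 0)// ?ltrN10//.
    by apply: divr_ge0; [apply: mulr_ge0 => //|]; exact: ltW.
  rewrite ln_div ?posrE// in H.
  have := ler_wpM2l (ltW beta_gt0) H.
  have -> : beta * ((s - t) * rho / (1 - s * rho)) = (s - t) * (beta * rho / (1 - s * rho)).
    by ring.
  lra.
Qed.

Variables (F : 'rV[R[i]]_n -> R[i]) (N : nat).
Hypothesis F_an : analytic_on_ball F.
Hypothesis F_index : Lindex_bound F L N.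

Lemma mderiv0 (z : 'rV[R[i]]_n) : mderiv [ffun=> 0%N] F z = F z.
Proof.
rewrite /mderiv; congr (_ z); elim: (enum 'I_n) => [//|k s IH].
by rewrite /= ffunE; exact: IH.
Qed.

Lemma normc_le_index (z : 'rV[R[i]]_n) : normc (F z) <= mmax N (fun S => Lcoef F L S z).
Proof.
pose Z : mindex n := [ffun=> 0%N].
have -> : normc (F z) = Lcoef F L Z z.
  rewrite /Lcoef mderiv0 /mfact /mpow !big1 ?mulr1 ?divr1// => j _.
  - by rewrite ffunE.
  - by rewrite ffunE.
apply: (mmax_ge N (fun S => Lcoef F L S z)).
by rewrite /mnorm big1// => j _; rewrite ffunE.
Qed.

(** As s_j <= N, the rate of [ray_index_growth] is at most (c + 1) N + 1 times the
    density. *)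
Lemma torus_growth r th (c : R) : angles th -> radii r -> r != 0 -> 0 <= c ->
  (forall j t, 0 <= t <= rstar r ->
     pospart (- dufun L j r th t) <= c * (r 0 j / rstar r * ufun L j r th t ^+ 2)) ->
  normc (F (polar r th)) <= mmax N (fun S => Lcoef F L S 0) *
    expR (((c + 1) * N%:R + 1) * ray_integral r th).
Proof.
move=> thA rr rn0 c0 Hc; have b0 := rstar_gt0 _ rr.1 rn0.
have w0 j : 0 <= r 0 j / rstar r by rewrite divr_ge0 ?(ltW b0)//; exact: rr.1.
have := ray_index_growth L F N L_pos L_C1 F_an F_index r th thA rr rn0.
rewrite /ray_index /ray divff ?gt_eqF// scale1r mul0r scale0r polar0 => H.
apply: le_trans (normc_le_index _) _; apply: le_trans H _.
apply: ler_wpM2l; first exact: mmax_ge0.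
have iD : lebesgue_measure.-integrable `[0, rstar r] (EFin \o ray_density r th).
  apply: continuous_compact_integrable; first exact: segment_compact.
  exact: ray_density_continuous.
rewrite ler_expR /ray_integral -RintegralZl//; apply: le_Rintegral => //.
- apply: continuous_compact_integrable; first exact: segment_compact.
  exact: rates_continuous.
- apply: continuous_compact_integrable; first exact: segment_compact.
  apply: cont_onM; first exact: cont_on_cst.
  exact: ray_density_continuous.
move=> t; rewrite /= in_itv/= => tr.
have D0 := ray_density_ge0 _ th _ rr rn0 tr.
have u0 j := ufun_gt0 L L_pos r th rr rn0 j t tr.
have leN (S : mindex n) j : (mnorm S <= N)%N -> (S j)%:R <= N%:R :> R.
  by move=> SN; rewrite ler_nat (leq_trans _ SN)// /mnorm (bigD1 j)//= leq_addr.
have -> : ((c + 1) * N%:R + 1) * ray_density r th t =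
  (N%:R + 1) * ray_density r th t + c * N%:R * ray_density r th t by ring.
apply: lerD; apply: mmax_le => [|S SN]; first by rewrite mulr_ge0// addr_ge0.
- rewrite mulr_sumr; apply: ler_sum => j _; rewrite mulrAC mulrC ler_wpM2r//.
    by rewrite mulr_ge0// ltW.
  by rewrite lerD2r leN.
- by rewrite !mulr_ge0.
- rewrite mulr_sumr; apply: ler_sum => j _; rewrite ler_pdivrMr//.
  apply: (@le_trans _ _ (N%:R * (c * (r 0 j / rstar r * ufun L j r th t ^+ 2)))).
    apply: ler_pM => //; [by rewrite /pospart le_max lexx orbT|exact: leN|exact: Hc].
  by rewrite le_eqVlt; apply/orP; left; apply/eqP; ring.
Qed.

End RayIntegral.

(** * Radii with vanishing coordinates, and points of a torus *)

Section Closure.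
Context {R : realType} {n : nat}.
Implicit Types (r th : 'rV[R]_n).

(** A point with positive coordinates close to r, in a direction that [ray_derivative]
    covers. *)
Definition lift_radii r (e : R) : 'rV[R]_n := r + e *: const_mx 1.

Lemma lift_radiiE r e j : lift_radii r e 0 j = r 0 j + e.
Proof. by rewrite !mxE mulr1. Qed.

Lemma enorm_lift r (e : R) : (forall j, 0 <= r 0 j) -> 0 <= e ->
  enorm r <= enorm (lift_radii r e).
Proof. by move=> r0 e0; apply: ler_enorm => j; rewrite lift_radiiE r0 lerDl. Qed.

Lemma radii_lift r : radii r ->
  exists2 d, 0 < d & forall e, 0 < e < d -> radii (lift_radii r e).
Proof.
move=> rr; have [r0 r1] := rr.
have s1 : \sum_(j < n) r 0 j ^+ 2 < 1.
  by have : enorm r < Num.sqrt 1; [rewrite sqrtr1 | rewrite /enorm ltr_sqrt].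
pose s := \sum_(j < n) r 0 j ^+ 2.
pose K : R := 3 * n%:R + 1; have K0 : 0 < K by rewrite ltr_wpDl// mulr_ge0.
(* for e <= 1 and r_j <= 1, the squared norm increases by at most 3 n e *)
exists (Num.min 1 ((1 - s) / K)); first by rewrite lt_min ltr01 divr_gt0// subr_gt0.
move=> e /andP[e0]; rewrite lt_min ltr_pdivlMr// => /andP[e1 eK].
split=> [j|]; first by rewrite lift_radiiE addr_ge0// ltW.
have -> : (1 : R) = Num.sqrt 1 by rewrite sqrtr1.
rewrite /enorm ltr_sqrt//; apply: (@le_lt_trans _ _ (s + e * (3 * n%:R))); last first.
  by rewrite /K in eK; lra.
have -> : e * (3 * n%:R) = \sum_(j < n) e * 3.
  by rewrite sumr_const card_ord -[RHS]mulr_natr mulrA.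
rewrite -big_split/=; apply: ler_sum => j _; rewrite lift_radiiE sqrrD -addrA lerD2l.
have rj1 : r 0 j <= 1.
  by apply: le_trans (ler_norm _) _; apply: le_trans (ler_coord_enorm r j) (ltW r1).
have : e * e <= e * 1 by rewrite ler_pM2l// ltW.
have : r 0 j * e <= 1 * e by rewrite ler_pM2r.
by rewrite -mulr_natr expr2; lra.
Qed.

(** Multiply the inequality by rstar and parametrize the ray by la = t / rstar in
    [0, 1].  Both sides are then continuous in e along the lifted radii, although
    rstar varies with e. *)
Lemma slope_bound_closure (L : 'I_n -> 'rV[R[i]]_n -> R) j th r (c d : R) :
  radially_C1 (L j) -> angles th -> radii r -> r != 0 -> 0 <= c -> 0 < d ->
  (forall e, 0 < e < d -> forall t, 0 <= t <= rstar (lift_radii r e) ->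
     pospart (- dufun L j (lift_radii r e) th t) <=
       c * (lift_radii r e 0 j / rstar (lift_radii r e) *
            ufun L j (lift_radii r e) th t ^+ 2)) ->
  forall t, 0 <= t <= rstar r ->
    pospart (- dufun L j r th t) <= c * (r 0 j / rstar r * ufun L j r th t ^+ 2).
Proof.
move=> LC1 thA rr rn0 c0 d0 H t tr; have [G [fG cG]] := ufun_partials _ _ _ LC1 thA.
set f := fun q => L j (polar q th) in fG.
have b0 := rstar_gt0 _ rr.1 rn0; have [t0 tb] := andP tr.
have w0 : 0 <= r 0 j / rstar r by rewrite divr_ge0 ?(ltW b0)//; exact: rr.1.
rewrite /pospart ge_max; apply/andP; split; last first.
  by apply: mulr_ge0 => //; apply: mulr_ge0 => //; exact: sqr_ge0.
pose la := t / rstar r.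
have la0 : 0 <= la by rewrite divr_ge0// ltW.
have la1 : la <= 1 by rewrite ler_pdivrMr// mul1r.
have [d1 d10 Hd1] := radii_lift _ rr.
pose psi e := c * ((r 0 j + e) * f (la *: lift_radii r e) ^+ 2) +
  \sum_(k < n) (r 0 k + e) * G k (la *: lift_radii r e).
have psi_ge0 : \forall e \near (0 : R)^'+, 0 <= psi e.
  apply/at_rightP; exists (Num.min d d1); first by rewrite lt_min d0.
  rewrite add0r => e /andP[e0]; rewrite lt_min => /andP[ed ed1].
  have re : radii (lift_radii r e) by apply: Hd1; rewrite e0.
  have rgt i : 0 < lift_radii r e 0 i by rewrite lift_radiiE ltr_wpDl//; exact: rr.1.
  have ren0 : lift_radii r e != 0.
    by apply: contraTneq (rgt j) => ->; rewrite mxE ltxx.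
  have be0 := rstar_gt0 _ re.1 ren0.
  have tI : 0 <= la * rstar (lift_radii r e) <= rstar (lift_radii r e).
    by rewrite mulr_ge0 ?(ltW be0)//= ler_piMl// ltW.
  have := H e; rewrite e0 ed => /(_ isT _ tI).
  rewrite /dufun -/f (derive_ray _ _ fG cG _ _ re ren0 tI) /ray_slope /ufun mulfK ?gt_eqF//.
  rewrite /pospart ge_max => /andP[+ _] => /(ler_wpM2r (ltW be0)).
  have -> : - (\sum_(k < n) lift_radii r e 0 k / rstar (lift_radii r e) *
      G k (la *: lift_radii r e)) * rstar (lift_radii r e) =
      - \sum_(k < n) (r 0 k + e) * G k (la *: lift_radii r e).
    rewrite mulNr mulr_suml; congr (- _); apply: eq_bigr => k _.
    by rewrite -lift_radiiE; field; rewrite gt_eqF.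
  have -> : c * (lift_radii r e 0 j / rstar (lift_radii r e) *
      L j (polar (la *: lift_radii r e) th) ^+ 2) * rstar (lift_radii r e) =
      c * ((r 0 j + e) * f (la *: lift_radii r e) ^+ 2).
    by rewrite -lift_radiiE /f; field; rewrite gt_eqF.
  by rewrite /psi; lra.
have rla : radii (la *: r) by exact: radii_ray.
have in_la e : 0 < e < d1 -> radii (la *: lift_radii r e).
  move=> ed; have := Hd1 e ed => re; apply: (radii_le _ _ _ re) => i.
  by rewrite mxE mulr_ge0//= ?ler_piMl//; exact: re.1.
have scaleE e : la *: lift_radii r e = la *: r + e *: (la *: const_mx 1).
  by rewrite /lift_radii scalerDr !scalerA mulrC.
have cvg_id0 : (fun e : R => e) @ (0 : R)^'+ --> (0 : R).
  by apply: cvg_at_right_filter; exact: cvg_id.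
have cvg_r k : (fun e => r 0 k + e) @ (0 : R)^'+ --> r 0 k.
  by rewrite -[X in _ --> X]addr0; apply: cvgD cvg_id0; exact: cvg_cst.
have cvgf : (fun e => f (la *: lift_radii r e)) @ (0 : R)^'+ --> f (la *: r).
  have w1 i : 0 <= (la *: const_mx 1 : 'rV[R]_n) 0 i by rewrite !mxE mulr1.
  have /dquot_withinP/(_ 1 ltr01)[d2 d20 Hd2] := ray_derivative _ _ _ _ fG cG rla w1.
  set l := \sum_(k < n) _ in Hd2.
  apply/cvgrPdist_le => e e0; have l1 : 0 < `|l| + 1 by rewrite ltr_wpDl.
  apply/at_rightP; exists (Num.min (Num.min d1 d2) (e / (`|l| + 1))).
    by rewrite !lt_min d10 d20 divr_gt0.
  rewrite add0r => h /andP[h0]; rewrite !lt_min ltr_pdivlMr// -andbA.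
  move=> /and3P[hd1 hd2 he]; have := Hd2 h; rewrite gtr0_norm// => /(_ hd2).
  rewrite -scaleE => /(_ (in_la h ltac:(rewrite h0//))) Hh.
  rewrite distrC -[X in `|X|](subrK (h * l)) (le_trans (ler_normD _ _))//.
  rewrite normrM (gtr0_norm h0); lra.
have cvgG k : (fun e => G k (la *: lift_radii r e)) @ (0 : R)^'+ --> G k (la *: r).
  apply/cvgrPdist_le => e e0.
  have /cvgrPdist_le/(_ e e0) := (subspace_continuousP _ _).1 (cG k) _ rla.
  rewrite near_withinE => /nbhs_ballP[d2 /= d20 Hd2].
  apply/at_rightP; exists (Num.min d1 d2); first by rewrite lt_min d10.
  rewrite add0r => h /andP[h0]; rewrite lt_min => /andP[hd1 hd2].
  apply: Hd2; last by apply: in_la; rewrite h0.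
  split=> // i k'; rewrite ord1 scaleE /ball/= !mxE mulr1 opprD addNKr normrN.
  rewrite normrM (gtr0_norm h0) (ger0_norm la0).
  by apply: le_lt_trans hd2; rewrite ler_piMr// ltW.
have cvgpsi : psi @ (0 : R)^'+ --> c * (r 0 j * f (la *: r) ^+ 2) +
    \sum_(k < n) r 0 k * G k (la *: r).
  apply: cvgD.
    apply: cvgM; first exact: cvg_cst.
    apply: cvgM => //; rewrite expr2; under eq_cvg do rewrite expr2.
    exact: cvgM.
  apply: cvg_big => [|k _]; first exact: add_continuous.
  by apply: cvgM.
have lim_ge0 : 0 <= c * (r 0 j * f (la *: r) ^+ 2) + \sum_(k < n) r 0 k * G k (la *: r).
  rewrite -(cvg_lim _ cvgpsi)//; apply: limr_ge psi_ge0.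
  by apply: cvgP; exact: cvgpsi.
rewrite /dufun -/f (derive_ray _ _ fG cG _ _ rr rn0 tr) /ray_slope /ufun -/la -/(f _).
rewrite -(ler_pM2r b0) mulNr mulr_suml.
have -> : c * (r 0 j / rstar r * f (la *: r) ^+ 2) * rstar r = c * (r 0 j * f (la *: r) ^+ 2).
  by field; rewrite gt_eqF.
have -> : \sum_(i < n) r 0 i / rstar r * G i (la *: r) * rstar r =
    \sum_(k < n) r 0 k * G k (la *: r).
  by apply: eq_bigr => k _; field; rewrite gt_eqF.
by lra.
Qed.

Lemma torus_polar r (z : 'rV[R[i]]_n) : torus r z -> exists2 th, angles th & z = polar r th.
Proof.
move=> zr; have coord j : exists th : R, 0 <= th <= 2 * pi /\
    z 0 j = ((r 0 j * cos th) +i* (r 0 j * sin th))%C.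
  have := zr j; case: (z 0 j) => x y /= <-.
  set rho := Num.sqrt _; have rho0 : 0 <= rho by exact: sqrtr_ge0.
  have rho2 : rho ^+ 2 = x ^+ 2 + y ^+ 2 by rewrite sqr_sqrtr// addr_ge0 ?sqr_ge0.
  have pi0 := pi_gt0 R.
  move: rho0; rewrite le_eqVlt => /predU1P[rho0|rho0].
    exists 0; rewrite lexx mulr_ge0 ?(ltW pi0)//; split => //.
    rewrite -rho0 !mul0r; move/eqP: rho2; rewrite -rho0 expr0n/= eq_sym.
    by rewrite paddr_eq0 ?sqr_ge0// !sqrf_eq0 => /andP[/eqP -> /eqP ->].
  have x1 : -1 <= x / rho <= 1.
    have : (x / rho) ^+ 2 <= 1.
      by rewrite expr_div_n ler_pdivrMr ?exprn_gt0// mul1r rho2 lerDl sqr_ge0.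
    by rewrite -ler_norml -[(_ / _) ^+ 2]real_normK ?num_real// expr_le1.
  have cosx := acosK x1; have [a0 api] := (acos_ge0 x1, acos_lepi x1).
  have sinx : sin (acos (x / rho)) = `|y| / rho.
    rewrite sin_acos//; have -> : 1 - (x / rho) ^+ 2 = (`|y| / rho) ^+ 2.
      rewrite !expr_div_n real_normK ?num_real// -[1](@divff _ (rho ^+ 2)) ?expf_neq0 ?gt_eqF//.
      by rewrite -mulrBl rho2 addrAC subrr add0r.
    by rewrite sqrtr_sqr ger0_norm// divr_ge0// ltW.
  have [y0|y0] := leP 0 y.
    exists (acos (x / rho)); split; first by rewrite a0/=; lra.
    by rewrite cosx sinx ger0_norm// ![rho * _]mulrC !divfK ?gt_eqF.
  exists (2 * pi - acos (x / rho)); split; first by apply/andP; split; lra.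
  rewrite mulr_natl addrC cosD2pi sinD2pi cosN sinN cosx sinx ltr0_norm//.
  by rewrite mulNr opprK ![rho * _]mulrC !divfK ?gt_eqF.
have [t Ht] := choice coord; exists (\row_j t j) => [j|].
  by rewrite mxE; have [] := Ht j.
by apply/rowP => j; rewrite !mxE; have [] := Ht j.
Qed.

End Closure.

(** * The upper limit of the growth ratio *)

Section GrowthRatio.
Context {R : realType} {n : nat}.
Variables (L : 'I_n -> 'rV[R[i]]_n -> R) (beta : R).
Hypothesis beta_gt0 : 0 < beta.
Hypothesis L_pos : forall j z, cball z -> 0 < L j z.
Hypothesis L_C1 : forall j, radially_C1 (L j).
Hypothesis L_beta : forall j z, cball z -> beta / (1 - cnorm z) < L j z.
Variables (F : 'rV[R[i]]_n -> R[i]) (N : nat).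
Hypothesis F_an : analytic_on_ball F.
Hypothesis F_index : Lindex_bound F L N.
Implicit Types (r th : 'rV[R]_n).

Definition slope_bound (c : R) r := forall th, angles th -> forall j t,
  0 <= t <= rstar r ->
  pospart (- dufun L j r th t) <= c * (r 0 j / rstar r * ufun L j r th t ^+ 2).

Let g0 := mmax N (fun S => Lcoef F L S 0).
(** The positive part makes g0 <= exp K hold also for g0 = 0. *)
Let K := pospart (ln g0).

Lemma index0_le : g0 <= expR K.
Proof.
have : 0 <= g0 := mmax_ge0 _ _.
rewrite le_eqVlt => /predU1P[<-|g_gt0]; first exact: expR_ge0.
by rewrite -[leLHS]lnK ?posrE// ler_expR /K /pospart le_max lexx.
Qed.

Lemma enorm_gt0 r : (forall j, 0 <= r 0 j) -> r != 0 -> 0 < enorm r.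
Proof.
move=> r0 rn0; apply: lt_le_trans (rstar_gt0 _ r0 rn0) _.
apply: bigmax_le => [|j _]; first exact: enorm_ge0.
exact: le_trans (ler_norm _) (ler_coord_enorm r j).
Qed.

(** The constant K is at most e times the denominator, which is bounded below by
    [ray_integral_ge].  When the denominator is infinite, the quotient is 0. *)
Lemma growth_ratio_le r (c e : R) : radii r -> r != 0 -> 0 <= c -> slope_bound c r ->
  0 < e -> K / e <= - beta * ln (1 - enorm r) ->
  (growth_ratio F L r <= ((c + 1) * N%:R + 1 + e)%:E)%E.
Proof.
move=> rr rn0 c0 Hc e0 He; set C0 := (c + 1) * N%:R + 1.
have C00 : 0 <= C0 by rewrite addr_ge0// mulr_ge0// addr_ge0.
have [r0 r1] := rr.
have m0 : 0 < - beta * ln (1 - enorm r).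
  rewrite mulNr -mulrN mulr_gt0// oppr_gt0 ln_lt0// subr_gt0 r1/=.
  by rewrite ltrBlDr ltrDl enorm_gt0.
set m := - beta * _ in He m0.
have A0 : angles (0 : 'rV[R]_n) by move=> j; rewrite mxE lexx mulr_ge0// pi_ge0.
rewrite /growth_ratio.
set X := ereal_sup _; set I := ereal_sup _.
have I_ge th : angles th -> ((ray_integral L r th)%:E <= I)%E.
  move=> thA; apply: ereal_sup_ubound; exists th => //.
  by apply: continuous_integral_EFin; exact: ray_density_continuous.
have mI : (m%:E <= I)%E.
  apply: le_trans (I_ge _ A0); rewrite lee_fin.
  exact: (ray_integral_ge L L_pos L_C1 beta beta_gt0 L_beta).
case: I mI I_ge => [i||] mI I_ge; last by rewrite leeNy_eq in mI.
- rewrite lee_fin in mI; have i0 := lt_le_trans m0 mI.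
  have X_le : (X <= (expR (K + C0 * i))%:E)%E.
    apply: ub_ereal_sup => _ [z zr <-]; rewrite lee_fin.
    have [th thA ->] := torus_polar _ _ zr.
    have := torus_growth L L_pos L_C1 F N F_an F_index r th c thA rr rn0 c0 (Hc th thA).
    move=> /le_trans; apply; rewrite expRD; apply: ler_pM; rewrite ?expR_ge0//.
    + exact: mmax_ge0.
    + exact: index0_le.
    + by rewrite ler_expR ler_wpM2l// -lee_fin; exact: I_ge.
  have lX : (lne X <= (K + C0 * i)%:E)%E.
    case: X X_le => [x|Xoo|_] /=; [|by rewrite leye_eq in Xoo|by rewrite leNye].
    rewrite lee_fin => xle; case: ifPn; first by rewrite leNye.
    rewrite -ltNge => x0; rewrite lee_fin -[leRHS]expRK.
    by rewrite ler_ln ?posrE// expR_gt0.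
  rewrite inver gt_eqF// lee_pdivrMr// -EFinM; apply: le_trans lX _; rewrite lee_fin.
  have Km : K <= m * e by rewrite -ler_pdivrMr.
  clearbody C0; rewrite mulrDl addrC lerD2l [e * i]mulrC; apply: le_trans Km _.
  by rewrite ler_pM2r.
- by rewrite invey mule0 lee_fin addr_ge0// ltW.
Qed.

Lemma limsup_growth_ratio (c d : R) : 0 <= c -> 0 < d ->
  (forall r, radii r -> 1 - d < enorm r -> r != 0 -> slope_bound c r) ->
  (limf_esup (growth_ratio F L) (to_sphere R n) <= ((c + 1) * N%:R + 1)%:E)%E.
Proof.
move=> c0 d0 Hc; apply/lee_addgt0Pr => e e0; rewrite -EFinD.
(* |R| > 1 - x makes - beta ln (1 - |R|) exceed K / e *)
pose x := expR (- (K / (e * beta))).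
pose d1 := Num.min (Num.min d 1) x.
have d10 : 0 < d1 by rewrite !lt_min d0 ltr01 expR_gt0.
pose V := [set r : 'rV[R]_n | (forall j, 0 <= r 0 j) /\ 1 - d1 < enorm r < 1].
apply: (@le_trans _ _ (ereal_sup [set growth_ratio F L r | r in V])).
  by apply: ereal_inf_lbound; exists V => //; exists d1.
apply: ub_ereal_sup => _ [r [r0 /andP[rd r1]] <-].
have rr : radii r by split.
move: rd; rewrite ltrBlDr -ltrBlDl !lt_min -andbA => /and3P[rd r_gt0 rx].
have rn0 : r != 0.
  apply: contraTneq r_gt0 => ->; rewrite -leNgt.
  rewrite /enorm big1 ?sqrtr0 ?subr0// => j _.
  by rewrite mxE expr0n.
apply: growth_ratio_le => //; first by apply: Hc => //; lra.
have : ln (1 - enorm r) <= - (K / (e * beta)).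
  by rewrite -[leRHS]expRK ler_ln ?posrE ?expR_gt0 ?subr_gt0// ltW.
rewrite -(ler_pM2l beta_gt0).
have -> : beta * - (K / (e * beta)) = - (K / e) by field; rewrite !gt_eqF.
lra.
Qed.

Lemma slope_bound_lift (c : R) r : radii r -> r != 0 -> 0 <= c ->
  (forall q, radii q -> (forall j, 0 < q 0 j) -> enorm r <= enorm q -> slope_bound c q) ->
  slope_bound c r.
Proof.
move=> rr rn0 c0 Hq th thA j t tr.
have [d d0 Hd] := radii_lift _ rr.
apply: (slope_bound_closure L j th r c d) => // e ed s sr.
have [e0 _] := andP ed; apply: Hq => //; first exact: Hd.
  by move=> k; rewrite lift_radiiE ltr_wpDl//; exact: rr.1.
by apply: enorm_lift; [exact: rr.1 | exact: ltW].
Qed.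

End GrowthRatio.

Theorem theorem15 (R : realType) (n : nat) (hn : (0 < n)%N)
    (beta : R) (hbeta : Num.sqrt n%:R < beta)
    (L : 'I_n -> 'rV[R[i]]_n -> R)
    (L_pos : forall j z, cball z -> 0 < L j z)
    (L_C1 : forall j, radially_C1 (L j))
    (L_beta : forall j z, cball z -> beta / (1 - cnorm z) < L j z)
    (F : 'rV[R[i]]_n -> R[i]) (F_an : analytic_on_ball F)
    (N : nat) (F_index : has_Lindex F L N) :
  (* (i) *)
  (forall th r : 'rV[R]_n, angles th -> radii r -> r != 0 ->
    (lne (mmax N (fun S => Lcoef F L S (polar r th)))%:E
     <= lne (mmax N (fun S => Lcoef F L S 0%R))%:E
        + \int[lebesgue_measure]_(tau in `[0%R, rstar r])
            (mmax N (fun S : mindex n =>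
               (\sum_(j < n) r 0 j / rstar r * ((S j)%:R + 1)
                  * ufun L j r th tau)%R)
             + mmax N (fun S : mindex n =>
               (\sum_(j < n) (S j)%:R * pospart (- dufun L j r th tau)
                  / ufun L j r th tau)%R))%:E)%E)
  /\
  (* (ii) *)
  (forall C : R, 0 < C ->
    (ereal_sup
       [set ereal_sup
          [set ereal_sup
             [set (\big[Num.max/0]_(j < n)
                     (pospart (- dufun L j r th t)
                      / (r 0 j / rstar r * ufun L j r th t ^+ 2)))%R%:E
             | th in angles]
          | t in `[0%R, rstar r]]
       | r in [set r : 'rV[R]_n | ((forall j, 0 < r 0 j) /\ enorm r < 1)%R]]
     <= C%:E)%E ->
    (limf_esup (growth_ratio F L) (to_sphere R n)
     <= ((C + 1) * N%:R + 1)%R%:E)%E)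
  /\
  (* (iii) *)
  ((forall eps : R, 0 < eps ->
      exists2 delta : R, 0 < delta & forall r : 'rV[R]_n,
        (forall j, 0 < r 0 j) -> 1 - delta < enorm r < 1 ->
        forall (th : 'rV[R]_n) (j : 'I_n) (t : R),
          angles th -> 0 <= t <= rstar r ->
          rstar r * pospart (- dufun L j r th t)
            / (r 0 j * ufun L j r th t ^+ 2) < eps) ->
    (limf_esup (growth_ratio F L) (to_sphere R n) <= (N%:R + 1)%R%:E)%E).
Proof.
have beta_gt0 : 0 < beta by apply: le_lt_trans hbeta; exact: sqrtr_ge0.
have F_bound := F_index.1.
have rn0_of (q : 'rV[R]_n) : (forall j, 0 < q 0 j) -> q != 0.
  move=> q0; apply: contraTneq (q0 (Ordinal hn)) => ->; by rewrite mxE ltxx.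
split; [|split].
- move=> th r thA rr rn0; have b0 := rstar_gt0 _ rr.1 rn0.
  rewrite continuous_integral_EFin; last exact: rates_continuous.
  have := ray_index_growth L F N L_pos L_C1 F_an F_bound r th thA rr rn0.
  rewrite /ray_index /ray divff ?gt_eqF// scale1r mul0r scale0r polar0.
  set g1 := mmax N _; set g0 := mmax N (fun S => Lcoef F L S 0).
  set I := Rintegral _ _ _ => H.
  rewrite /lne; case: ifPn; first by rewrite leNye.
  rewrite -ltNge => g1_gt0.
  have g0_gt0 : 0 < g0.
    rewrite ltNge; apply: contraTN g1_gt0 => g00; rewrite -leNgt.
    by apply: le_trans H _; rewrite mulr_le0_ge0 ?expR_ge0.
  have /negbTE -> : ~~ (g0 <= 0) by rewrite -ltNge.
  rewrite -EFinD lee_fin -[I]expRK -lnM ?posrE ?expR_gt0//.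
  by rewrite ler_ln ?posrE// mulr_gt0// expR_gt0.
- move=> C C0 HC.
  apply: (limsup_growth_ratio L beta beta_gt0 L_pos L_C1 L_beta F N F_an F_bound C 1) => //.
    exact: ltW.
  move=> r rr _ rn0; apply: slope_bound_lift => //; first exact: ltW.
  move=> q rq q_gt0 _ th thA j t tq.
  have b0 := rstar_gt0 _ rq.1 (rn0_of q q_gt0).
  have u0 := ufun_gt0 L L_pos q th rq (rn0_of q q_gt0) j t tq.
  have D0 : 0 < q 0 j / rstar q * ufun L j q th t ^+ 2.
    by apply: mulr_gt0; [exact: divr_gt0 | exact: exprn_gt0].
  rewrite -ler_pdivrMr// -lee_fin; apply: le_trans HC.
  apply: ereal_sup_ge; eexists; first by exists q => //; split => //; exact: rq.2.
  apply: ereal_sup_ge; eexists; first by exists t => //; rewrite /= in_itv.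
  apply: ereal_sup_ge; eexists; first by exists th.
  by rewrite lee_fin; exact: (le_bigmax_cond _ (fun j => pospart (- dufun L j q th t) /
    (q 0 j / rstar q * ufun L j q th t ^+ 2))).
- move=> H; apply/lee_addgt0Pr => e e0; rewrite -EFinD.
  (* c N <= e *)
  pose c := e / (N%:R + 1); have N1 : 0 < N%:R + 1 :> R by rewrite ltr_wpDl.
  have c0 : 0 < c by rewrite divr_gt0.
  apply: (@le_trans _ _ ((c + 1) * N%:R + 1)%:E); last first.
    rewrite lee_fin; have : c * N%:R <= e.
      by rewrite /c mulrAC ler_pdivrMr// ler_pM2l// lerDl.
    lra.
  have [d d0 Hd] := H c c0.
  apply: (limsup_growth_ratio L beta beta_gt0 L_pos L_C1 L_beta F N F_an F_bound c d) => //.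
    exact: ltW.
  move=> r rr rd rn0; apply: slope_bound_lift => //; first exact: ltW.
  move=> q rq q_gt0 rle th thA j t tq.
  have b0 := rstar_gt0 _ rq.1 (rn0_of q q_gt0).
  have u0 := ufun_gt0 L L_pos q th rq (rn0_of q q_gt0) j t tq.
  have qd : 1 - d < enorm q < 1 by rewrite (lt_le_trans rd rle) rq.2.
  have := Hd q q_gt0 qd th j t thA tq.
  rewrite ltr_pdivrMr; last by rewrite mulr_gt0// exprn_gt0.
  move=> /ltW; rewrite mulrC -ler_pdivlMr// => /le_trans; apply.
  by rewrite le_eqVlt; apply/orP; left; apply/eqP; ring.
Qed.
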